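(* Let $H$ be the graph on vertex set $\{0,1,2,3\}$ with red edge set $\{\{0,1\},\{0,2\}\}$ and blue edge set $\{\{0,3\},\{1,2\},\{1,3\}\}$. For every $n\ge 4$ it holds that $\Lambda_H(n)\le n\,\pi_3(n-1)$. Moreover, for $n\ge 4$: (1) If $n$ is $0$, $2$ or $5$ modulo $6$, then $\Lambda_H(n)=n\,\pi_3(n-1)$, and a graph $G$ of order $n$ satisfies $\Lambda_H(G)=\Lambda_H(n)$ if and only if $G$ is $\lceil n/3\rceil$-regular and triangle-free. (2) If $n=6k+3$ for a non-negative integer $k$, then $\Lambda_H(n)=n\,\pi_3(n-1)-2k$, and a graph $G$ of order $n$ satisfies $\Lambda_H(G)=\Lambda_H(n)$ if and only if $G$ is triangle-free, has exactly $n-1$ vertices of degree $2k+1$, and has one vertex of degree $2k+2$. (3) If $n=6k+1$ or $n=6k+4$ with integer $k\to\infty$, then $$6k^2+O(k)\le n\,\pi_3(n-1)-\Lambda_H(n)\le \frac{15}{2}k^2+O(k).$$ In particular, $\lambda_H=1/27$. Furthermore, for graphs $G$ of (arbitrary) order $n\to\infty$, one has $\lambda_H(G)=1/27+o(1)$ if and only if $G$ has triangle density $o(1)$ and is almost $1/3$-regular.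
   Context: All graphs are finite and simple; the order of a graph is its number of vertices. For a graph $H$ with $\kappa$ vertices whose edges are coloured red or blue and an uncoloured graph $G$ of order $n\ge\kappa$, an embedding of $H$ into $G$ is an injection $V(H)\to V(G)$ that maps red edges of $H$ to edges of $G$ and blue edges of $H$ to non-edges of $G$ (pairs of distinct non-adjacent vertices). $\Lambda_H(G)$ is the number of embeddings, $\Lambda_H(n)$ is the maximum of $\Lambda_H(G)$ over all graphs $G$ of order $n$, $\lambda_H(G):=\Lambda_H(G)/\big(n(n-1)\cdots(n-\kappa+1)\big)$, $\lambda_H(n)$ is the maximum of $\lambda_H(G)$ over graphs of order $n$, and $\lambda_H:=\lim_{n\to\infty}\lambda_H(n)$ (the limit exists). For a non-negative integer $N$, $\pi_3(N)$ is the maximum product of three non-negative integers that sum to $N$, i.e. $\pi_3(N)=\lfloor N/3\rfloor\lfloor (N+1)/3\rfloor\lfloor (N+2)/3\rfloor$. The triangle density of $G$ is the number of $3$-subsets of $V(G)$ spanning a triangle divided by $\binom{n}{3}$. A sequence of graphs with orders tending to infinity is almost $c$-regular if for every $\varepsilon>0$, all but finitely many graphs $G$ of the sequence have at least $(1-\varepsilon)v(G)$ vertices $u$ with $|\deg_G(u)/v(G)-c|\le\varepsilon$, where $v(G)$ is the order of $G$. The last assertion of the claim is about sequences of graphs $G$ whose orders $n$ tend to infinity, with $o(1)$ taken along the sequence. In (3), each $O(k)$ denotes a quantity bounded in absolute value by an absolute constant times $k$. *)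

(* Defs.v *)
From HB Require Import structures.
From mathcomp Require Import all_boot all_order all_algebra.
From mathcomp Require Import all_classical all_reals all_analysis.

Set Implicit Arguments.
Unset Strict Implicit.
Unset Printing Implicit Defensive.

Import Order.TTheory GRing.Theory Num.Theory.
Import numFieldNormedType.Exports.

Local Open Scope ring_scope.

Record sgraph (T : finType) := SGraph {
  edges :> {set {set T}};
  _ : [forall e in edges, #|e| == 2]
}.
HB.instance Definition _ (T : finType) := [isSub for @edges T].
HB.instance Definition _ (T : finType) := [Finite of sgraph T by <:].

Definition adj (T : finType) (G : sgraph T) (u v : T) : bool :=
  [set u; v]%SET \in edges G.

Definition deg (T : finType) (G : sgraph T) (u : T) : nat :=
  #|[set v | adj G u v]|.

Definition regular (T : finType) (d : nat) (G : sgraph T) : Prop :=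
  forall u, deg G u = d.

Definition triangles (T : finType) (G : sgraph T) : {set {set T}} :=
  [set A : {set T} | (#|A| == 3)
     && [forall u in A, forall v in A, (u != v) ==> adj G u v]].

Definition triangle_free (T : finType) (G : sgraph T) : Prop :=
  triangles G = finset.set0.

Record cgraph (V : finType) := CGraph {
  red : sgraph V;
  blue : sgraph V;
  _ : [disjoint edges red & edges blue]
}.

Definition embedding (V T : finType) (H : cgraph V) (G : sgraph T)
    (f : {ffun V -> T}) : bool :=
  [&& injectiveb f,
      [forall e in edges (red H), (f @: e)%SET \in edges G] &
      [forall e in edges (blue H), (f @: e)%SET \notin edges G]].

Definition Lambda (V T : finType) (H : cgraph V) (G : sgraph T) : nat :=
  #|[set f : {ffun V -> T} | embedding H G f]|.

(* Embedding counts are invariant under isomorphism, so the vertex set may be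
   taken to be 'I_n. *)
Definition Lambda_max (V : finType) (H : cgraph V) (n : nat) : nat :=
  (\max_(G : sgraph 'I_n) Lambda H G)%N.

(* Only meaningful when #|V| <= #|T|; otherwise the value is 0. *)
Definition lambda (R : realType) (V T : finType) (H : cgraph V)
    (G : sgraph T) : R :=
  (Lambda H G)%:R / (#|T| ^_ #|V|)%:R.

Definition lambda_max (R : realType) (V : finType) (H : cgraph V)
    (n : nat) : R :=
  \big[Num.max/0]_(G : sgraph 'I_n) lambda R H G.

Definition lambda_lim (R : realType) (V : finType) (H : cgraph V) : R :=
  limn (lambda_max R H).

Definition triangle_density (R : realType) (T : finType) (G : sgraph T) : R :=
  #|triangles G|%:R / 'C(#|T|, 3)%:R.

Definition almost_regular (R : realType) (c : R) (T : nat -> finType)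
    (G : forall i, sgraph (T i)) : Prop :=
  forall eps : R, 0 < eps -> \forall i \near \oo%classic,
    (1 - eps) * #|T i|%:R <=
      #|[set u : T i | `|(deg (G i) u)%:R / #|T i|%:R - c| <= eps]|%:R.

Definition pi3 (N : nat) : nat :=
  (\max_(t : {ffun 'I_3 -> 'I_N.+1} | (\sum_i t i)%N == N) \prod_i t i)%N.

Local Notation vtx k := (@Ordinal 4 k isT).

Definition H_red_edges : {set {set 'I_4}} :=
  [set [set vtx 0; vtx 1]; [set vtx 0; vtx 2]]%SET.

Definition H_blue_edges : {set {set 'I_4}} :=
  [set [set vtx 0; vtx 3]; [set vtx 1; vtx 2]; [set vtx 1; vtx 3]]%SET.

Fact H_red_subproof : [forall e in H_red_edges, #|e| == 2].
Proof. by apply/forall_inP => e /set2P[]->; rewrite cards2. Qed.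

Fact H_blue_subproof : [forall e in H_blue_edges, #|e| == 2].
Proof.
by apply/forall_inP => e; rewrite !inE => /orP[/orP[]|] /eqP->; rewrite cards2.
Qed.

Definition H_red : sgraph 'I_4 := SGraph H_red_subproof.
Definition H_blue : sgraph 'I_4 := SGraph H_blue_subproof.

Fact H_disjoint : [disjoint edges H_red & edges H_blue].
Proof.
rewrite disjoint_subset; apply/fintype.subsetP => e /set2P[]->; rewrite !inE;
  apply/negP => /orP[/orP[]|] /eqP /setP E;
  by move: (E (vtx 0)) (E (vtx 1)) (E (vtx 2)) (E (vtx 3)); rewrite !inE.
Qed.

(* The pair {2, 3} is uncoloured. *)
Definition H4 : cgraph 'I_4 := CGraph H_disjoint.

(* Main.v *)
Require Import Defs.
From mathcomp Require Import all_boot all_order all_algebra.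
From mathcomp Require Import all_classical all_reals all_analysis.
From mathcomp Require Import zify ring lra.

(* Write an embedding as (u, x, y, z) with u, x, y, z the images of 0, 1, 2, 3,
   and sum over x first.  For an edge xu the choices of y and z are independent:
   y is one of the W neighbours of u lying outside N(x) + x, and z is one of the
   Z common non-neighbours of x and u.  As deg x + W + Z = n - 1, every x
   contributes at most pi3 (n - 1), with equality only if deg x, W and Z are
   balanced for all its neighbours u; W = deg u - 1 exactly when the codegree of
   x and u vanishes.  For n = 6k + 3 parity forbids regularity, and one vertex
   of degree 2k + 2 is the cheapest defect.
   For n = 3M + 1 with M real, put a_x = deg x - M and let c be the codegree of
   x and u.  Then
     n M^3 - Lambda = sum_x a_x^2 (3M - a_x) / 4
                      + sum_(x ~ u) (1 + c - a_u - a_x / 2)^2,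
   a sum of nonnegative terms.  If M is an integer, every edge has to pay at
   least 1, which gives the 6k^2 of (3).  In general, the shortfall is o(n^4)
   iff sum a_x^2 = o(n^3) and the total codegree is o(n^3), that is, iff the
   graph is almost 1/3-regular with triangle density o(1). *)

Set Implicit Arguments.
Unset Strict Implicit.
Unset Printing Implicit Defensive.

Import Order.TTheory GRing.Theory Num.Theory.
Import numFieldNormedType.Exports.

Local Open Scope nat_scope.

(** * Graphs, codegrees and triangles *)

Lemma card_setE (T : finType) (P : pred T) : #|[set x | P x]%SET| = \sum_x P x.
Proof. by rewrite -sum1dep_card big_mkcond; apply: eq_bigr => x _; case: (P x). Qed.

Lemma sum_pred1 (T : finType) (x : T) : \sum_y (y == x : nat) = 1.
Proof.
rewrite (bigD1 x) //= eqxx big1 // => y; case: eqP => //.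
Qed.

Section Graph.
Variables (T : finType) (G : sgraph T).
Implicit Types u v x y z : T.

Lemma adjC u v : adj G u v = adj G v u.
Proof. by rewrite /adj finset.setUC. Qed.

Lemma adj_neq u v : adj G u v -> u != v.
Proof.
case: G => E hE; rewrite /adj /= => h; have := forall_inP hE _ h.
by rewrite cards2; case: (u != v).
Qed.

Lemma adjxx u : adj G u u = false.
Proof. by apply/negP => /adj_neq; rewrite eqxx. Qed.

Definition codeg u v := #|[set w | adj G u w && adj G v w]%SET|.

(** This is W of the overview, the images left for vertex 2 once 0 goes to u and 1 to x;
    [common_nonnbrs] is Z, the same for vertex 3. Here y differs from u because it is adjacent to
    u. *)
Definition private_nbrs x u :=
  #|[set y | [&& y != x, adj G u y & ~~ adj G x y]]%SET|.

Definition common_nonnbrs x u :=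
  #|[set z | [&& z != u, z != x, ~~ adj G u z & ~~ adj G x z]]%SET|.

Lemma degE u : deg G u = \sum_v adj G u v.
Proof. exact: card_setE. Qed.

Lemma sum_nbrs_const u c : \sum_(v | adj G u v) c = deg G u * c.
Proof. by rewrite sum_nat_const /deg cardsE. Qed.

Lemma codegC u v : codeg u v = codeg v u.
Proof. by apply: eq_card => w; rewrite !inE andbC. Qed.

Lemma private_nbrsE x u : adj G x u ->
  private_nbrs x u + 1 + codeg x u = deg G u.
Proof.
move=> xu; rewrite degE /private_nbrs /codeg !card_setE -(sum_pred1 x).
rewrite -!big_split /=; apply: eq_bigr => y _.
case: (eqVneq y x) => [->|yx] /=; first by rewrite adjC xu adjxx.
by case: (adj G u y); case: (adj G x y).
Qed.

Lemma common_nonnbrsE x u : adj G x u ->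
  deg G x + private_nbrs x u + common_nonnbrs x u + 1 = #|T|.
Proof.
move=> xu; rewrite degE /private_nbrs /common_nonnbrs !card_setE -(sum_pred1 x).
rewrite -sum1_card -!big_split /=; apply: eq_bigr => y _.
case: (eqVneq y x) => [->|yx] /=; first by rewrite adjxx andbF.
case: (eqVneq y u) => [->|yu] /=; first by rewrite adjxx xu.
by case: (adj G u y); case: (adj G x y).
Qed.

Lemma deg_lt_card u : deg G u < #|T|.
Proof.
rewrite -cardsT; apply: proper_card; rewrite properT.
by apply/eqP => /finset.setP /(_ u); rewrite !inE adjxx.
Qed.

End Graph.

Section Triangles.
Variables (T : finType) (G : sgraph T).

Definition ordered_triangles :=
  [set p : T * T * T | [&& adj G p.1.1 p.1.2, adj G p.1.1 p.2 & adj G p.1.2 p.2]]%SET.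

Lemma sum_codeg : \sum_x \sum_(u | adj G x u) codeg G x u = #|ordered_triangles|.
Proof.
rewrite /ordered_triangles card_setE.
transitivity (\sum_x \sum_u \sum_w [&& adj G x u, adj G x w & adj G u w]).
  apply: eq_bigr => x _; rewrite big_mkcond; apply: eq_bigr => u _.
  by rewrite /codeg card_setE; case: (adj G x u) => //=; rewrite big1.
by rewrite !pair_big /=; apply: eq_bigr => -[[x u] w].
Qed.

Definition triangle_support (p : T * T * T) := [set p.1.1; p.1.2; p.2]%SET.

Lemma triangle_support_image :
  (triangle_support @: ordered_triangles)%SET = triangles G.
Proof.
apply/finset.setP => A; apply/imsetP/idP => [[[[x u] w]]|].
  rewrite !inE /= => /and3P[xu xw uw] ->; rewrite /triangle_support /=; apply/andP; split.
    by rewrite -finset.setUA cardsU1 !inE cards2 negb_or !(adj_neq xu, adj_neq xw, adj_neq uw).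
  apply/forall_inP => a; rewrite !inE => ha.
  apply/forall_inP => b; rewrite !inE => hb; apply/implyP.
  by case/orP: ha => [/orP[]|] /eqP ->; case/orP: hb => [/orP[]|] /eqP ->;
     rewrite ?eqxx // => _; rewrite ?xu ?uw ?xw // adjC ?xu ?uw ?xw.
rewrite inE => /andP[/eqP cA /forall_inP tA].
have {}cA : #|A| = 3 := cA.
have ad a b : a \in A -> b \in A -> a != b -> adj G a b.
  by move=> aA bA; apply/implyP; apply: (forall_inP (tA a aA)).
have /card_gt0P[u uA] : 0 < #|A| by rewrite cA.
have /eqP/cards2P[v [w [vw E]]] : #|A :\ u|%SET = 2 by move: cA; rewrite (cardsD1 u) uA => -[].
have : v \in (A :\ u)%SET by rewrite E !inE eqxx.
have : w \in (A :\ u)%SET by rewrite E !inE eqxx orbT.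
rewrite !inE => /andP[wu wA] /andP[vu vA]; exists (u, v, w).
  by rewrite inE /= !ad // eq_sym.
by rewrite /triangle_support /= -finset.setUA -E finset.setD1K.
Qed.

Lemma card_triangles_le : #|triangles G| <= #|ordered_triangles|.
Proof. by rewrite -triangle_support_image leq_imset_card. Qed.

(** All triples supported on a triangle A lie in the cube of A. The factor 27 instead of 6 is
    harmless, since only orders of magnitude matter. *)
Lemma card_ordered_triangles_le : #|ordered_triangles| <= #|triangles G| * 27.
Proof.
rewrite -sum1_card (partition_big_imset triangle_support) /= triangle_support_image.
rewrite -sum_nat_const; apply: leq_sum => A; rewrite inE => /andP[/eqP cA _].
have {}cA : #|A| = 3 := cA.
have -> : 27 = #|finset.setX (finset.setX A A) A| by rewrite !cardsX cA.
rewrite sum1_card; apply/subset_leq_card/fintype.subsetP => -[[x u] w].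
by rewrite !inE => /andP[_ /eqP <-]; rewrite /triangle_support /= !inE !eqxx !orbT.
Qed.

Lemma triangle_freeP :
  triangle_free G <-> forall u v, adj G u v -> codeg G u v = 0.
Proof.
rewrite /triangle_free -triangle_support_image; split=> [/eqP|cod0].
  rewrite imset_eq0 -cards_eq0 -sum_codeg sum_nat_eq0 => /forallP h u v uv.
  by have := h u; rewrite sum_nat_eq0 => /forall_inP /(_ v uv) /eqP.
apply/eqP; rewrite imset_eq0 -cards_eq0 -sum_codeg; apply/eqP.
by apply: big1 => u _; apply: big1 => v; exact: cod0.
Qed.

End Triangles.

Section GraphOf.
Variables (T : finType) (e : rel T).

(** The size condition drops loops and unordered pairs forget direction, so every relation yields a
    legal graph. *)
Definition rel_edges : {set {set T}} :=
  [set A : {set T} | (#|A| == 2) && [exists u, exists v, e u v && (A == [set u; v]%SET)]]%SET.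

Fact rel_edges_card2 : [forall A in rel_edges, #|A| == 2].
Proof. by apply/forall_inP => A; rewrite inE => /andP[]. Qed.

Definition graph_of : sgraph T := SGraph rel_edges_card2.

Lemma adj_graph_of : symmetric e -> irreflexive e -> adj graph_of =2 e.
Proof.
move=> esym eirr u v; rewrite /adj inE cards2.
apply/idP/idP => [/andP[nuv /existsP[a /existsP[b /andP[eab /eqP E]]]]|euv].
  have ha : a \in [set u; v]%SET by rewrite E !inE eqxx.
  have hb : b \in [set u; v]%SET by rewrite E !inE eqxx orbT.
  move: eab; rewrite !inE in ha hb.
  by case/orP: ha => /eqP->; case/orP: hb => /eqP->; rewrite ?eirr // esym.
apply/andP; split.
  by suff -> : u != v by []; apply: contraTneq euv => ->; rewrite eirr.
by apply/existsP; exists u; apply/existsP; exists v; rewrite euv eqxx.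
Qed.

End GraphOf.

Section Pullback.
Variables (S T : finType) (h : S -> T).
Hypothesis h_inj : injective h.
Variable G : sgraph T.

Fact pullback_card2 : [forall A in [set A : {set S} | (h @: A)%SET \in edges G]%SET, #|A| == 2].
Proof.
apply/forall_inP => A; rewrite inE => hA.
by rewrite -(card_imset _ h_inj); case: G hA => E hE /(forall_inP hE).
Qed.

Definition pullback : sgraph S := SGraph pullback_card2.

End Pullback.

(** * The embedding count as a sum over edges *)

(** [Lambda_max] ranges over graphs on an ordinal only. Pulling G back along [enum_val] gives such a
    graph, and composing with [enum_rank] carries embeddings injectively. *)
Lemma Lambda_le_max (V T : finType) (H : cgraph V) (G : sgraph T) :
  Lambda H G <= Lambda_max H #|T|.
Proof.
have hK : cancel (enum_rank : T -> 'I_#|T|) enum_val by exact: enum_rankK.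
have Kh : cancel (enum_val : 'I_#|T| -> T) enum_rank by exact: enum_valK.
have hinj : injective (enum_val : 'I_#|T| -> T) by exact: can_inj Kh.
apply: leq_trans (leq_bigmax (pullback hinj G)).
rewrite /Lambda -(@card_imset _ _ (fun f : {ffun V -> T} => [ffun i => enum_rank (f i)] : {ffun V -> 'I_#|T|})); last first.
  by move=> f g /ffunP E; apply/ffunP => i; have := E i; rewrite !ffunE => /(can_inj hK).
apply/subset_leq_card/fintype.subsetP => _ /imsetP[f + ->]; rewrite !inE => femb.
have E (A : {set V}) : ((enum_val : 'I_#|T| -> T) @: ([ffun i => enum_rank (f i)] @: A) = f @: A)%SET.
  by rewrite -imset_comp; apply: eq_imset => i; rewrite /= ffunE hK.
case/and3P: femb => /injectiveP fi /forall_inP fr /forall_inP fb; apply/and3P; split.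
- by apply/injectiveP => i j; rewrite !ffunE => /(can_inj hK) /fi.
- by apply/forall_inP => A /fr; rewrite inE E.
- by apply/forall_inP => A /fb; rewrite inE E.
Qed.

Definition quad (T : Type) (p : T * T * T * T) : 'I_4 -> T :=
  fun i => match val i with 0 => p.1.1.1 | 1 => p.1.1.2 | 2 => p.1.2 | _ => p.2 end.

(** The pair {2, 3} carries no colour, so once x and u are fixed the conditions on y and on z are
    separate and the count is a product. *)
Lemma Lambda_H4 (T : finType) (G : sgraph T) :
  Lambda H4 G =
  \sum_x \sum_(u | adj G x u) private_nbrs G x u * common_nonnbrs G x u.
Proof.
pose Q (p : T * T * T * T) := let: (((u, x), y), z) := p in
  [&& adj G x u, [&& y != x, adj G u y & ~~ adj G x y] &
      [&& z != u, z != x, ~~ adj G u z & ~~ adj G x z]].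
have embE p : embedding H4 G [ffun i => quad p i] = Q p.
  case: p => [[[u x] y] z].
  rewrite /embedding.
  have imE (i j : 'I_4) : ([ffun i => quad (u, x, y, z) i] @: [set i; j] =
     [set quad (u, x, y, z) i; quad (u, x, y, z) j])%SET.
    by rewrite imsetU1 imset_set1 !ffunE.
  apply/and3P/and3P => [[/injectiveP inj /forall_inP r /forall_inP b]|[xu /and3P[yx uy xy] /and4P[zu zx uz xz]]].
    have a01 : adj G u x.
      by have := r [set @Ordinal 4 0 isT; @Ordinal 4 1 isT]%SET; rewrite imE; apply; rewrite !inE eqxx.
    have a02 : adj G u y.
      by have := r [set @Ordinal 4 0 isT; @Ordinal 4 2 isT]%SET; rewrite imE; apply; rewrite !inE eqxx ?orbT.
    have a03 : ~~ adj G u z.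
      by have := b [set @Ordinal 4 0 isT; @Ordinal 4 3 isT]%SET; rewrite imE; apply; rewrite !inE eqxx ?orbT.
    have a12 : ~~ adj G x y.
      by have := b [set @Ordinal 4 1 isT; @Ordinal 4 2 isT]%SET; rewrite imE; apply; rewrite !inE eqxx ?orbT.
    have a13 : ~~ adj G x z.
      by have := b [set @Ordinal 4 1 isT; @Ordinal 4 3 isT]%SET; rewrite imE; apply; rewrite !inE eqxx ?orbT.
    have n (i j : 'I_4) : i != j -> quad (u, x, y, z) i != quad (u, x, y, z) j.
      by apply: contra => /eqP E; apply/eqP/inj; rewrite !ffunE.
    split; first by rewrite adjC.
      by rewrite a02 a12 (n (@Ordinal 4 2 isT) (@Ordinal 4 1 isT)).
    by rewrite a03 a13 (n (@Ordinal 4 3 isT) (@Ordinal 4 1 isT)) ?(n (@Ordinal 4 3 isT) (@Ordinal 4 0 isT)).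
  have ux := adj_neq xu; have uy' := adj_neq uy.
  (* Even injectivity does not couple y and z: one is adjacent to u and the other is not. *)
  have yz : y != z by apply: contraNneq uz => <-.
  split.
  - apply/injectiveP => -[[|[|[|[|i]]]] Hi] [[|[|[|[|j]]]] Hj] //; rewrite !ffunE /quad /= => E;
      try exact: val_inj; exfalso; move/eqP: E; apply/negP => //; by rewrite // eq_sym.
  - apply/forall_inP => A /set2P[]->; rewrite imE; last exact: uy.
    by move: xu; rewrite adjC.
  - apply/forall_inP => A; rewrite !inE => /orP[/orP[]|] /eqP ->; rewrite imE -/(adj _ _ _) //.
have -> : Lambda H4 G = \sum_(p | Q p) 1.
  rewrite /Lambda -sum1dep_card.
  rewrite (reindex (fun p => [ffun i => quad p i] : {ffun 'I_4 -> T})) /=.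
    by apply: eq_bigl => p; rewrite embE.
  exists (fun f => (f (@Ordinal 4 0 isT), f (@Ordinal 4 1 isT), f (@Ordinal 4 2 isT), f (@Ordinal 4 3 isT))).
    by move=> [[[u x] y] z] _; rewrite !ffunE.
  move=> f _; apply/ffunP => -[[|[|[|[|i]]]] Hi] //; rewrite ffunE /quad /=; congr (f _); exact: val_inj.
rewrite [RHS](exchange_big_dep xpredT) //=.
transitivity (\sum_u \sum_x \sum_y \sum_z (Q (u, x, y, z) : nat)).
  rewrite !pair_big /= big_mkcond; apply: eq_bigr => -[[[u x] y] z] _ /=.
  by rewrite -/(Q (u, x, y, z)); case: (Q _).
apply: eq_bigr => u _; rewrite [RHS]big_mkcond; apply: eq_bigr => x _ /=.
case: (adj G x u) => /=; last by rewrite big1 // => y _; rewrite big1.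
rewrite /private_nbrs /common_nonnbrs !card_setE big_distrl /=; apply: eq_bigr => y _.
rewrite big_distrr /=; apply: eq_bigr => z _.
by rewrite -mulnb.
Qed.

(** * Products of three numbers with a given sum *)

Lemma leq_pi3 N a b c : a + b + c = N -> a * b * c <= pi3 N.
Proof.
move=> abc.
have ha : a < N.+1 by lia. have hb : b < N.+1 by lia. have hc : c < N.+1 by lia.
pose t : {ffun 'I_3 -> 'I_N.+1} :=
  [ffun i => match val i with 0 => Ordinal ha | 1 => Ordinal hb | _ => Ordinal hc end].
have := @leq_bigmax_cond _ (fun t : {ffun 'I_3 -> 'I_N.+1} => (\sum_i t i == N)) (fun t => \prod_i t i) t.
rewrite !big_ord_recl !big_ord0 !ffunE /= addn0 muln1 addnA mulnA; apply; exact/eqP.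
Qed.

Lemma pi3_leq N B : (forall a b c, a + b + c = N -> a * b * c <= B) -> pi3 N <= B.
Proof.
move=> h; apply/bigmax_leqP => t; rewrite !big_ord_recl !big_ord0 addn0 muln1 addnA mulnA.
by move=> /eqP; apply: h.
Qed.

Lemma pi3_attained N a b c B : a + b + c = N -> a * b * c = B ->
  (forall a b c, a + b + c = N -> a * b * c <= B) -> pi3 N = B.
Proof.
move=> s p h; apply/eqP; rewrite eqn_leq pi3_leq //= -p; exact: leq_pi3.
Qed.

Lemma AGM3 t w z : 4 * (t * w * z) <= t * (w + z) ^ 2.
Proof. by have := leq_mul (leqnn t) (nat_AGM2 w z); lia. Qed.

Lemma odd_AGM2 b c s : b + c = 2 * s + 1 -> b * c <= s * (s + 1).
Proof. by move=> E; have [] := nat_AGM2 b c; rewrite E => h _; lia. Qed.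

(** In the three cubic bounds one part is m + i or m + 2 + i, and j is the sum of the other two.
    Expressing 2m by i and j turns the doubled difference of the two sides into a polynomial with
    nonnegative coefficients. *)
Lemma cubic_bound_0 m i j : 2 * m = i + j -> (m + i) * j ^ 2 <= 4 * (m * m * m).
Proof.
move=> h.
have : 8 * (m * m * m) = (i + j) ^ 3 by rewrite -h; ring.
have : 2 * ((m + i) * j ^ 2) = (i + j + 2 * i) * j ^ 2 by rewrite -h; ring.
have : (i + j) ^ 3 = (i + j + 2 * i) * j ^ 2 + i ^ 3 + 3 * i ^ 2 * j by ring.
lia.
Qed.

Lemma cubic_bound_1 m i j : 2 * m = i + j + 1 ->
  (m + 2 + i) * j ^ 2 < 4 * (m * m * (m + 1)).
Proof.
move=> h.
have : 8 * (m * m * (m + 1)) = (i + j + 1) ^ 2 * (i + j + 3).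
  by rewrite (_ : i + j + 3 = 2 * (m + 1)) -?h; [ring | lia].
have : 2 * ((m + 2 + i) * j ^ 2) = (3 * i + j + 5) * j ^ 2.
  by rewrite (_ : 3 * i + j + 5 = 2 * (m + 2 + i)); [ring | lia].
have : (i + j + 1) ^ 2 * (i + j + 3) = (3 * i + j + 5) * j ^ 2
  + i ^ 3 + 3 * i ^ 2 * j + 5 * i ^ 2 + 10 * i * j + 7 * i + 7 * j + 3 by ring.
lia.
Qed.

Lemma cubic_bound_2 m i j : 2 * m = i + j ->
  (m + 2 + i) * j ^ 2 + 4 * m <= 4 * (m * (m + 1) * (m + 1)).
Proof.
move=> h.
have : 8 * (m * (m + 1) * (m + 1)) = (i + j) * (i + j + 2) ^ 2 by rewrite -h; ring.
have : 2 * ((m + 2 + i) * j ^ 2) = (3 * i + j + 4) * j ^ 2.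
  by rewrite (_ : 3 * i + j + 4 = 2 * (m + 2 + i)); [ring | lia].
have : (i + j) * (i + j + 2) ^ 2 = (3 * i + j + 4) * j ^ 2
  + i ^ 3 + 3 * i ^ 2 * j + 4 * i ^ 2 + 8 * i * j + 4 * i + 4 * j by ring.
lia.
Qed.

Lemma prod3_le_0 m a b c : a + b + c = 3 * m -> a * b * c <= m * m * m.
Proof.
move=> s; have := AGM3 a b c; have -> : b + c = 3 * m - a by lia.
have [am|ma] := leqP a m.
  have [i Ei] : exists i, m = a + i by exists (m - a); lia.
  subst m; have -> : 3 * (a + i) - a = 2 * a + 3 * i by lia. nia.
have [i Ei] : exists i, a = m + i by exists (a - m); lia.
have [j Ej] : exists j, 2 * m = i + j by exists (2 * m - i); lia.
have := cubic_bound_0 Ej; subst a; have -> : 3 * m - (m + i) = j by lia.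
lia.
Qed.

Lemma pi3_0 m : pi3 (3 * m) = m * m * m.
Proof. apply: (@pi3_attained _ m m m) => //; [lia | exact: prod3_le_0]. Qed.

Lemma prod3_le_1 m a b c : a + b + c = 3 * m + 1 -> a * b * c <= m * m * (m + 1).
Proof.
move=> s.
wlog le : a b c s / a <= m.
  move=> h; have [?|am] := leqP a m; first exact: h.
  have [bm|bm] := leqP b m; first by rewrite (mulnC a b); apply: h => //; lia.
  have cm : c <= m by lia.
  by rewrite mulnC mulnA; apply: h => //; lia.
have [i Ei] : exists i, m = a + i by exists (m - a); lia.
(* If a = m, the other parts have the odd sum 2m + 1, where plain AM-GM is too weak and [odd_AGM2]
   is needed. *)
case: i Ei => [|i] Ei.
  have := @odd_AGM2 b c m; nia.
have := AGM3 a b c; have -> : b + c = 2 * a + 3 * i.+1 + 1 by lia.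
subst m; nia.
Qed.

Lemma pi3_1 m : pi3 (3 * m + 1) = m * m * (m + 1).
Proof. apply: (@pi3_attained _ m m (m + 1)) => //; [lia | exact: prod3_le_1]. Qed.

Lemma prod3_le_2 m a b c : a + b + c = 3 * m + 2 -> a * b * c <= m * (m + 1) * (m + 1).
Proof.
move=> s.
wlog le : a b c s / m < a.
  move=> h; have [am|?] := leqP a m; last exact: h.
  have [bm|bm] := leqP b m; last by rewrite (mulnC a b); apply: h => //; lia.
  have cm : m < c by lia.
  by rewrite mulnC mulnA; apply: h => //; lia.
have [i Ei] : exists i, a = m + 1 + i by exists (a - m - 1); lia.
case: i Ei => [|i] Ei.
  have := @odd_AGM2 b c m; nia.
have [j Ej] : exists j, 2 * m = i + j by exists (2 * m - i); lia.
have := AGM3 a b c; have -> : b + c = j by lia.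
have := cubic_bound_2 Ej; have -> : a = m + 2 + i by lia.
lia.
Qed.

Lemma pi3_2 m : pi3 (3 * m + 2) = m * (m + 1) * (m + 1).
Proof. apply: (@pi3_attained _ m (m + 1) (m + 1)) => //; [lia | exact: prod3_le_2]. Qed.

Lemma prod3_eq_1 m a b c : a + b + c = 3 * m + 1 ->
  a * b * c = m * m * (m + 1) -> m <= a <= m + 1.
Proof.
move=> s p; have := AGM3 a b c; rewrite p; apply: contraTT.
rewrite negb_and -!ltnNge => /orP[am|am].
  have [i Ei] : exists i, m = a + i.+1 by exists (m - a - 1); lia.
  have -> : b + c = 2 * a + 3 * i.+1 + 1 by lia.
  subst m; nia.
have [i Ei] : exists i, a = m + 2 + i by exists (a - m - 2); lia.
have [m0|m0] := posnP m; first by subst; lia.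
have [j Ej] : exists j, 2 * m = i + j + 1.
  by exists (2 * m - 1 - i); lia.
have := cubic_bound_1 Ej; have -> : b + c = j by lia.
by subst a.
Qed.

(** For m = 0 the maximum is 0 and the parts 2, 0, 0 attain it; hence the positivity of m. *)
Lemma prod3_eq_2 m a b c : 0 < m -> a + b + c = 3 * m + 2 ->
  a * b * c = m * (m + 1) * (m + 1) -> m <= a <= m + 1.
Proof.
move=> m0 s p; have := AGM3 a b c; rewrite p; apply: contraTT.
rewrite negb_and -!ltnNge => /orP[am|am].
  have [i Ei] : exists i, m = a + i.+1 by exists (m - a - 1); lia.
  have -> : b + c = 2 * a + 3 * i.+1 + 2 by lia.
  subst m; nia.
have [i Ei] : exists i, a = m + 2 + i by exists (a - m - 2); lia.
have [j Ej] : exists j, 2 * m = i + j by exists (2 * m - i); lia.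
have := cubic_bound_2 Ej; have -> : b + c = j by lia.
subst a; lia.
Qed.

(** * The upper bound and its equality case *)

Lemma sum_eq_max (I : finType) (P : pred I) (f : I -> nat) c :
  (forall i, P i -> f i <= c) -> \sum_(i | P i) f i = \sum_(i | P i) c ->
  forall i, P i -> f i = c.
Proof.
move=> le E i Pi; apply/eqP; have := leqif_sum (fun i Pi => leqif_eq (le i Pi)).
by case=> _ /esym; rewrite E eqxx => /forall_inP /(_ i Pi).
Qed.

Section UpperBound.
Variables (T : finType) (G : sgraph T).
Implicit Types u v x y z : T.

(** By the edge formula, this is the number of embeddings that send vertex 1 to x. *)
Definition vcount x :=
  \sum_(u | adj G x u) private_nbrs G x u * common_nonnbrs G x u.

Lemma Lambda_vcount : Lambda H4 G = \sum_x vcount x.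
Proof. exact: Lambda_H4. Qed.

Lemma parts_sum x u : adj G x u ->
  deg G x + private_nbrs G x u + common_nonnbrs G x u = #|T|.-1.
Proof. by move=> xu; rewrite -(common_nonnbrsE xu) addn1. Qed.

Lemma parts_le x u : adj G x u ->
  deg G x * private_nbrs G x u * common_nonnbrs G x u <= pi3 #|T|.-1.
Proof. by move=> xu; apply: leq_pi3; exact: parts_sum. Qed.

Lemma deg_vcount x : deg G x * vcount x =
  \sum_(u | adj G x u) deg G x * private_nbrs G x u * common_nonnbrs G x u.
Proof. by rewrite big_distrr /=; apply: eq_bigr => u _; rewrite mulnA. Qed.

Lemma adj_deg_gt0 x u : adj G x u -> 0 < deg G x.
Proof. by move=> xu; apply/card_gt0P; exists u; rewrite inE. Qed.

Lemma vcount_deg0 x : deg G x = 0 -> vcount x = 0.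
Proof. by move=> d0; apply: big1 => u /adj_deg_gt0; rewrite d0. Qed.

(** Multiplication by deg x turns the sum into deg x products of three parts of n - 1, each at most
    [pi3]; dividing again gives the bound. *)
Lemma vcount_le x : vcount x <= pi3 #|T|.-1.
Proof.
have [d0|d0] := posnP (deg G x); first by rewrite vcount_deg0.
rewrite -(leq_pmul2l d0) deg_vcount -sum_nbrs_const.
by apply: leq_sum => u; exact: parts_le.
Qed.

Lemma Lambda_upper : Lambda H4 G <= #|T| * pi3 #|T|.-1.
Proof.
rewrite Lambda_vcount -sum_nat_const.
by apply: leq_sum => x _; exact: vcount_le.
Qed.

Lemma Lambda_max_parts : Lambda H4 G = #|T| * pi3 #|T|.-1 ->
  forall x u, adj G x u ->
  deg G x * private_nbrs G x u * common_nonnbrs G x u = pi3 #|T|.-1.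
Proof.
rewrite Lambda_vcount -sum_nat_const => /(sum_eq_max (fun x _ => vcount_le x)) E x u.
move: u; apply: (@sum_eq_max _ (adj G x) (fun u => _ * _ * _) _ (@parts_le x)).
by rewrite -deg_vcount E // sum_nbrs_const.
Qed.

Lemma Lambda_max_deg_gt0 : 0 < pi3 #|T|.-1 -> Lambda H4 G = #|T| * pi3 #|T|.-1 ->
  forall x, 0 < deg G x.
Proof.
move=> p0; rewrite Lambda_vcount -sum_nat_const.
move=> /(sum_eq_max (fun x _ => vcount_le x)) E x; rewrite lt0n; apply/negP => /eqP d0.
by move: p0; rewrite -(E x) // vcount_deg0.
Qed.

Lemma triangle_free_vcount x : triangle_free G -> vcount x =
  \sum_(u | adj G x u) (deg G u - 1) * (#|T| - deg G x - deg G u).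
Proof.
move=> /triangle_freeP tf; apply: eq_bigr => u xu.
have := private_nbrsE xu; have := common_nonnbrsE xu; rewrite (tf _ _ xu) => h1 h2.
congr (_ * _); lia.
Qed.

Lemma regular_Lambda d : regular d G -> triangle_free G ->
  Lambda H4 G = #|T| * (d * ((d - 1) * (#|T| - d - d))).
Proof.
move=> reg tf; rewrite Lambda_vcount -sum_nat_const; apply: eq_bigr => x _.
rewrite triangle_free_vcount // -[in RHS](reg x) -sum_nbrs_const.
by apply: eq_bigr => u xu; rewrite !reg.
Qed.

(** Equality puts deg x and W into {d - 1, d}. As deg u = W + 1 + codegree, a neighbour u of x has
    degree at least d, hence exactly d with codegree 0; and every vertex is a neighbour of some
    other. *)
Lemma Lambda_maxP d : 2 <= d -> #|T| = 3 * d \/ #|T| + 1 = 3 * d ->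
  Lambda H4 G = #|T| * pi3 #|T|.-1 <-> regular d G /\ triangle_free G.
Proof.
move=> d2 Td; split=> [E|[reg tf]]; last first.
  rewrite (regular_Lambda reg tf); case: Td => Td.
    have -> : #|T|.-1 = 3 * (d - 1) + 2 by lia.
    rewrite pi3_2 Td; have [e Ee] : exists e, d = e + 1 by exists (d - 1); lia.
    by subst d; rewrite !addnK (_ : 3 * (e + 1) - (e + 1) - (e + 1) = e + 1); lia.
  have -> : #|T|.-1 = 3 * (d - 1) + 1 by lia.
  rewrite pi3_1; have [e Ee] : exists e, d = e + 1 by exists (d - 1); lia.
  by subst d; rewrite !addnK (_ : #|T| - (e + 1) - (e + 1) = e); lia.
have bal x u : adj G x u -> deg G x <= d /\ d - 1 <= private_nbrs G x u.
  move=> xu; have p := Lambda_max_parts E xu; have s := parts_sum xu.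
  (* The equality lemmas speak of the first factor only, so the factors are permuted to reach W. *)
  have p' : private_nbrs G x u * deg G x * common_nonnbrs G x u = pi3 #|T|.-1.
    by rewrite [_ * deg G x]mulnC.
  have s' : private_nbrs G x u + deg G x + common_nonnbrs G x u = #|T|.-1 by lia.
  case: Td => Td.
    have N : #|T|.-1 = 3 * (d - 1) + 2 by lia.
    rewrite N pi3_2 in p p' s s'.
    have d0 : 0 < d - 1 by lia.
    have := prod3_eq_2 d0 s p; have := prod3_eq_2 d0 s' p'; lia.
  have N : #|T|.-1 = 3 * (d - 1) + 1 by lia.
  rewrite N pi3_1 in p p' s s'.
  have := prod3_eq_1 s p; have := prod3_eq_1 s' p'; lia.
have p0 : 0 < pi3 #|T|.-1.
  case: Td => Td.
    by rewrite (_ : #|T|.-1 = 3 * (d - 1) + 2) ?pi3_2 ?muln_gt0; lia.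
  by rewrite (_ : #|T|.-1 = 3 * (d - 1) + 1) ?pi3_1 ?muln_gt0; lia.
have pos := Lambda_max_deg_gt0 p0 E.
have le x : deg G x <= d.
  by have /card_gt0P[u] := pos x; rewrite inE => /bal[].
have ge x u : adj G x u -> deg G u = d /\ codeg G x u = 0.
  move=> xu; have [_ h] := bal _ _ xu; have := le u; have := private_nbrsE xu; lia.
split=> [u|]; last by apply/triangle_freeP => x u /ge[].
have /card_gt0P[x] := pos u; rewrite inE adjC => /ge[] //.
Qed.

End UpperBound.

(** * Orders congruent to 3 modulo 6 *)

(** Ranking the vertices splits the degree sum into pairs going up and pairs going down, two equal
    numbers. *)
Lemma handshake (T : finType) (G : sgraph T) : ~~ odd (\sum_u deg G u).
Proof.
pose lt (u v : T) := enum_rank u < enum_rank v.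
have -> : \sum_u deg G u = \sum_u \sum_v (lt u v && adj G u v) + \sum_u \sum_v (lt v u && adj G u v).
  rewrite -big_split /=; apply: eq_bigr => u _; rewrite degE -big_split /=.
  apply: eq_bigr => v _; rewrite /lt; case: ltngtP => //=; rewrite ?addn0 //.
  by move=> /val_inj /enum_rank_inj ->; rewrite adjxx.
rewrite [X in _ + X]exchange_big /=.
have -> : \sum_j \sum_i (lt j i && adj G i j) = \sum_u \sum_v (lt u v && adj G u v).
  by apply: eq_bigr => u _; apply: eq_bigr => v _; rewrite adjC.
by rewrite addnn odd_double.
Qed.

Section NearRegular.
Variables (T : finType) (G : sgraph T) (k : nat).
Hypothesis cardT : #|T| = 6 * k + 3.
Implicit Types u v x y z : T.

Local Notation d := (2 * k + 1).
Local Notation P := (pi3 #|T|.-1).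
Local Notation w x u := (private_nbrs G x u).

(** The subtraction never truncates, by [vcount_le]. *)
Definition defect x := P - vcount G x.

Lemma pi3_card : P = d * d * (2 * k).
Proof.
rewrite cardT (_ : (6 * k + 3).-1 = 3 * (2 * k) + 2); last lia.
by rewrite pi3_2; lia.
Qed.

Hypothesis k_gt0 : 0 < k.

Lemma Lambda_defect : Lambda H4 G + \sum_x defect x = #|T| * P.
Proof.
rewrite Lambda_vcount -sum_nat_const -big_split /=.
by apply: eq_bigr => x _; rewrite subnKC // vcount_le.
Qed.

Lemma vcount_quad x : 4 * vcount G x <= deg G x * (#|T|.-1 - deg G x) ^ 2.
Proof.
rewrite -sum_nbrs_const big_distrr /=; apply: leq_sum => u xu.
have := parts_sum xu; have [] := nat_AGM2 (private_nbrs G x u) (common_nonnbrs G x u).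
by move=> h _ s; rewrite (_ : #|T|.-1 - _ = private_nbrs G x u + common_nonnbrs G x u); lia.
Qed.

(** A cost of d = 2k + 1 already exceeds the total 2k that an optimal graph can afford; likewise for
    degrees that are too high. *)
Lemma defect_low x : deg G x <= d - 2 -> d <= defect x.
Proof.
move=> h; have := vcount_quad x; rewrite /defect pi3_card.
have [i Ei] : exists i, 2 * k = deg G x + i + 1 by exists (2 * k - 1 - deg G x); lia.
have -> : #|T|.-1 - deg G x = 2 * deg G x + 3 * i + 5 by rewrite cardT; lia.
move: (deg G x) (vcount G x) Ei => t v Ei.
have -> : d = t + i + 2 by lia.
rewrite Ei; nia.
Qed.

Lemma defect_high x : d + 2 <= deg G x -> d <= defect x.
Proof.
move=> h; have := vcount_quad x; rewrite /defect pi3_card.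
have [i Ei] : exists i, deg G x = 2 * k + 3 + i by exists (deg G x - (2 * k + 3)); lia.
have := deg_lt_card G x => lt.
have [j Ej] : exists j, 4 * k = i + 1 + j by exists (4 * k - i - 1); lia.
have -> : #|T|.-1 - deg G x = j by rewrite cardT; lia.
rewrite Ei; move: (vcount G x) => v hv.
suff : (2 * k + 3 + i) * j ^ 2 + 4 * (2 * k + 1) <= 4 * (d * d * (2 * k)) by lia.
have E1 : 2 * ((2 * k + 3 + i) * j ^ 2) = (3 * i + j + 7) * j ^ 2.
  by rewrite (_ : 3 * i + j + 7 = 2 * (2 * k + 3 + i)); [ring | lia].
have E2 : 2 * (4 * (d * d * (2 * k))) = (i + j + 3) ^ 2 * (i + j + 1).
  have -> : i + j + 3 = 4 * k + 2 by lia.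
  have -> : i + j + 1 = 4 * k by lia.
  by ring.
have E3 : (i + j + 3) ^ 2 * (i + j + 1) = (3 * i + j + 7) * j ^ 2
  + i ^ 3 + 3 * i ^ 2 * j + 7 * i ^ 2 + 14 * i * j + 15 * (i + j) + 9 by ring.
lia.
Qed.

(** Here W + Z = 4k, so x contributes at most (2k + 2)(2k)^2, which is 2k less than (2k + 1)^2 (2k).
    One such vertex uses up the whole budget. *)
Lemma defect_d1 x : deg G x = d + 1 -> 2 * k <= defect x.
Proof.
move=> h; rewrite /defect pi3_card.
have : vcount G x <= (d + 1) * (2 * k * (2 * k)).
  rewrite -h -sum_nbrs_const; apply: leq_sum => u xu.
  have := parts_sum xu; rewrite h cardT => s.
  have [] := nat_AGM2 (private_nbrs G x u) (common_nonnbrs G x u).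
  rewrite (_ : private_nbrs G x u + common_nonnbrs G x u = 2 * (2 * k)); last lia.
  move=> + _; nia.
move: (vcount G x) => v; nia.
Qed.

(** With deg x given, W + Z is fixed and M is the largest value of W Z. Lowering W to d - 2 or less
    costs at least 2 in that single summand. *)
Lemma defect_nbr x v : adj G x v -> d - 1 <= deg G x <= d -> w x v <= d - 2 ->
  2 <= defect x.
Proof.
move=> xv dx wv.
have [M Mdef Mle] : exists2 M, deg G x * M = P &
    forall u, adj G x u -> w x u * common_nonnbrs G x u + 2 * (w x u <= d - 2) <= M.
  have {dx} [dx|dx] : deg G x = d \/ deg G x = 2 * k by lia.
    exists (d * (2 * k)) => [|u xu]; first by rewrite dx pi3_card; ring.
    have := parts_sum xu; rewrite dx cardT.
    move: (w x u) (common_nonnbrs G x u) => a b s.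
    case: (leqP a (d - 2)) => [h|_] /=.
      have -> : b = 4 * k + 1 - a by lia.
      have [i Ei] : exists i, 2 * k = a + i + 1 by exists (2 * k - 1 - a); lia.
      have -> : 4 * k + 1 - a = a + 2 * i + 3 by lia.
      have -> : d = a + i + 2 by lia.
      rewrite Ei; nia.
    have := @odd_AGM2 a b (2 * k); lia.
  exists (d * d) => [|u xu]; first by rewrite dx pi3_card; ring.
  have := parts_sum xu; rewrite dx cardT.
  move: (w x u) (common_nonnbrs G x u) => a b s.
  case: (leqP a (d - 2)) => [h|_] /=.
    have [i Ei] : exists i, 2 * k = a + i + 1 by exists (2 * k - 1 - a); lia.
    have -> : b = a + 2 * i + 4 by lia.
    have -> : d = a + i + 2 by lia.
    nia.
  have [h _] := nat_AGM2 a b; rewrite (_ : a + b = 2 * d) in h; last lia.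
  lia.
have : vcount G x + 2 <= P; last by rewrite /defect; lia.
rewrite -Mdef -sum_nbrs_const /vcount (bigD1 v) //= [X in _ <= X](bigD1 v) //=.
have := Mle v xv; rewrite wv muln1 => h.
have : \sum_(i | adj G x i && (i != v)) private_nbrs G x i * common_nonnbrs G x i <=
  \sum_(i | adj G x i && (i != v)) M.
  by apply: leq_sum => u /andP[xu _]; have := Mle u xu; lia.
rewrite /= in h *; lia.
Qed.

Hypothesis small : \sum_x defect x <= 2 * k.

Lemma defect_le x : defect x <= 2 * k.
Proof. by apply: leq_trans small; rewrite (bigD1 x) //= leq_addr. Qed.

Lemma defect2_le x y : x != y -> defect x + defect y <= 2 * k.
Proof.
move=> xy; apply: leq_trans small; rewrite (bigD1 x) //= (bigD1 y) 1?eq_sym //=.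
by rewrite addnA leq_addr.
Qed.

Lemma deg_range x : deg G x = 2 * k \/ deg G x = d \/ deg G x = d + 1.
Proof.
have h := defect_le x.
have h1 : ~~ (deg G x <= d - 2) by apply/negP => /defect_low; lia.
have h2 : ~~ (d + 2 <= deg G x) by apply/negP => /defect_high; lia.
lia.
Qed.

(** If deg v = 2k, then W at v is at most d - 2 seen from any neighbour, so each of the 2k
    neighbours has defect at least 2, which makes 4k > 2k in total. *)
Lemma deg_neq_2k v : deg G v != 2 * k.
Proof.
apply/eqP => dv.
have h x : adj G v x -> 2 <= defect x.
  move=> vx; have xv : adj G x v by rewrite adjC.
  have := private_nbrsE xv => pn; case: (deg_range x) => [dx|[dx|/defect_d1]]; last lia.
    by apply: (defect_nbr xv); lia.
  by apply: (defect_nbr xv); lia.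
have : 2 * k * 2 <= 2 * k; last lia.
rewrite -{1}dv -sum_nbrs_const; apply: leq_trans small.
rewrite [X in _ <= X](bigID (adj G v)) /=; apply: leq_trans (leq_addr _ _).
exact: leq_sum.
Qed.

(** Otherwise all degrees are the odd number d, on an odd number of vertices. *)
Lemma exists_deg_d1 : exists p, deg G p = d + 1.
Proof.
case: (boolP [exists p, deg G p == d + 1]) => [/existsP[p /eqP ?]|]; first by exists p.
rewrite negb_exists => /forallP h; exfalso.
have := handshake G; rewrite (eq_bigr (fun=> d)).
  rewrite sum_nat_const cardT.
  have -> : (6 * k + 3) * d = (6 * k * k + 6 * k + 1).*2.+1 by lia.
  by rewrite oddS odd_double.
move=> x _; have := deg_neq_2k x; have := h x; have := deg_range x; lia.
Qed.

Lemma near_regular : exists p,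
  [/\ deg G p = d + 1, forall x, x != p -> deg G x = d,
     triangle_free G & \sum_x defect x = 2 * k].
Proof.
have [p dp] := exists_deg_d1; exists p.
have Dp := defect_d1 dp.
(* The vertex p alone exhausts the budget 2k. *)
have D0 x : x != p -> defect x = 0.
  by move=> xp; have := defect2_le xp; lia.
have dx x : x != p -> deg G x = d.
  move=> xp; have := deg_neq_2k x; have := deg_range x.
  have : deg G x != d + 1; last lia.
  by apply/eqP => /defect_d1; rewrite D0 //; lia.
have c0 x u : x != p -> u != p -> adj G x u -> codeg G x u = 0.
  move=> xp up xu; have := private_nbrsE xu; rewrite dx // => e.
  apply/eqP; rewrite -leqn0 leqNgt; apply/negP => c0.
  by have := @defect_nbr x u xu; rewrite D0 // dx //; lia.
(* A triangle through p contains an edge that avoids p, and such edges have codegree 0. *)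
have c0p x : adj G x p -> codeg G x p = 0.
  move=> xp; apply/eqP; rewrite cards_eq0; apply/eqP/finset.setP => q.
  rewrite !inE; apply/negP => /andP[xq pq].
  have qp : q != p by rewrite eq_sym (adj_neq pq).
  have := c0 x q (adj_neq xp) qp xq; apply/eqP.
  by rewrite -lt0n; apply/card_gt0P; exists p; rewrite inE xp adjC.
split=> //.
  apply/triangle_freeP => u v uv.
  have [eu|un] := eqVneq u p; first by rewrite codegC; subst u; apply: c0p; rewrite adjC.
  by have [ev|vn] := eqVneq v p; [subst v; apply: c0p | apply: c0].
apply/eqP; rewrite eqn_leq small /=; apply: leq_trans Dp _.
by rewrite [X in _ <= X](bigD1 p) //= leq_addr.
Qed.

End NearRegular.

(** Being adjacent to p costs nothing, because the factors 2k and 2k + 1 merely change places. Only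
    p itself falls short, by 2k. *)
Lemma near_regular_Lambda (T : finType) (G : sgraph T) k p : #|T| = 6 * k + 3 ->
  triangle_free G -> deg G p = 2 * k + 2 -> (forall x, x != p -> deg G x = 2 * k + 1) ->
  Lambda H4 G + 2 * k = #|T| * pi3 #|T|.-1.
Proof.
move=> cardT tf dp dx; have PE := pi3_card cardT.
rewrite Lambda_vcount (bigD1 p) //= (eq_bigr (fun=> pi3 #|T|.-1)) => [|x xp].
  have -> : vcount G p = deg G p * (2 * k * (2 * k)).
    rewrite triangle_free_vcount // -sum_nbrs_const; apply: eq_bigr => u pu.
    have up : u != p by rewrite eq_sym (adj_neq pu).
    by rewrite dp dx // cardT; congr (_ * _); lia.
  rewrite sum_nat_const dp (_ : #|[pred i | i != p]| = 6 * k + 2).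
    by rewrite PE cardT; ring.
  by rewrite (@eq_card _ _ (predC1 p)) // cardC1 cardT; lia.
rewrite triangle_free_vcount // PE (_ : _ * _ = deg G x * ((2 * k + 1) * (2 * k))).
  rewrite -sum_nbrs_const; apply: eq_bigr => u xu; rewrite cardT (dx x) //.
  have [->|up] := eqVneq u p; first by rewrite dp; congr (_ * _); lia.
  by rewrite dx // [RHS]mulnC; congr (_ * _); lia.
by rewrite dx //; ring.
Qed.

(** * Bipartite graphs with prescribed degrees *)

Section Biregular.
Variable M : nat.

Definition residue_count a b j := \sum_(a <= t < b) (t %% M == j).

Lemma residue_count_window a j : j < M -> residue_count a (a + M) j = 1.
Proof.
move=> jM; elim: a => [|a IH].
  rewrite /residue_count add0n big_mkord (bigD1 (Ordinal jM)) //= modn_small // eqxx.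
  rewrite big1 // => i ij; rewrite modn_small //; case: eqP => // E.
  by move: ij; rewrite -val_eqE /= E eqxx.
move: IH; rewrite /residue_count big_ltn; last by lia.
by rewrite addSn big_nat_recr /= ?modnDr; lia.
Qed.

Lemma residue_count_le1 a r j : j < M -> r <= M -> residue_count a (a + r) j <= 1.
Proof.
move=> jM rM; rewrite -(residue_count_window a jM) /residue_count.
by rewrite [X in _ <= X](@big_cat_nat _ _ _ (a + r)) /= ?leq_addr ?leq_add2l.
Qed.

Lemma residue_count_total c j : j < M -> residue_count 0 (M * c) j = c.
Proof.
move=> jM; elim: c => [|c IH]; first by rewrite muln0 /residue_count big_geq.
rewrite /residue_count (@big_cat_nat _ _ _ (M * c)) ?leq_mul2l ?leqnSn ?orbT //=.
by move: IH; rewrite mulnSr /residue_count => ->; rewrite -/(residue_count _ _ _) residue_count_window ?addn1.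
Qed.

End Biregular.

(** The intervals are laid end to end, so the offsets are partial sums. They are chosen before F
    because each column will sum its own indicator. *)
Lemma consecutive_intervals (A : eqType) (r : A -> nat) (s : seq A) : uniq s ->
  exists off : A -> nat, forall F : nat -> nat,
    \sum_(a <- s) \sum_(off a <= t < off a + r a) F t =
    \sum_(0 <= t < \sum_(a <- s) r a) F t.
Proof.
elim/last_ind: s => [_|s a IH].
  by exists (fun=> 0) => F; rewrite !big_nil ?big_geq.
rewrite rcons_uniq => /andP[as_ us]; have [off Hoff] := IH us.
exists (fun x => if x == a then \sum_(b <- s) r b else off x) => F.
rewrite -cats1 !big_cat !big_seq1 /= eqxx.
rewrite [RHS](@big_cat_nat _ _ _ (\sum_(b <- s) r b)) ?leq_addr //= -Hoff.
congr (_ + _); apply: eq_big_seq => b bs; case: eqP => // ba.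
by rewrite ba (negPf as_) in bs.
Qed.

(* Row [a] receives [r a] cyclically consecutive columns, starting where the
   previous row stopped. *)
Lemma biregular_relation (A B : finType) (r : A -> nat) c :
  (forall a, r a <= #|B|) -> \sum_a r a = #|B| * c ->
  exists e : A -> B -> bool,
    (forall a, \sum_b e a b = r a) /\ (forall b, \sum_a e a b = c).
Proof.
move=> rle rsum; have [off Hoff] := consecutive_intervals r (index_enum_uniq A).
pose n a (b : B) := residue_count #|B| (off a) (off a + r a) (enum_rank b).
exists (fun a b => 0 < n a b).
(* A row of length at most #|B| meets each column at most once, so no edge is doubled. *)
have nE a b : (0 < n a b : nat) = n a b.
  have := residue_count_le1 (off a) (ltn_ord (enum_rank b)) (rle a).
  by rewrite -/(n a b); case: (n a b) => [|[]].
split=> [a|b]; under eq_bigr do rewrite nE.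
  rewrite /n /residue_count exchange_big /=; have [r0|r0] := posnP (r a).
    by rewrite r0 addn0 big_geq.
  rewrite (eq_bigr (fun=> 1)) => [|t _]; first by rewrite sum_nat_const_nat muln1 addKn.
  have tB : t %% #|B| < #|B| by rewrite ltn_mod (leq_trans r0).
  rewrite -(sum_pred1 (enum_val (Ordinal tB))); apply: eq_bigr => b _.
  by rewrite -(inj_eq enum_rank_inj) enum_valK -val_eqE eq_sym.
by rewrite Hoff rsum; exact: residue_count_total.
Qed.

Section BipartiteGraph.
Variables (A B : finType) (m : A -> B -> bool).

Definition bip_rel (u v : A + B) : bool :=
  match u, v with
  | inl a, inr b => m a b
  | inr b, inl a => m a b
  | _, _ => false
  end.

Definition bip_graph := graph_of bip_rel.

Lemma adj_bip : adj bip_graph =2 bip_rel.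
Proof. by apply: adj_graph_of => [[a|b] [a'|b']|[a|b]]. Qed.

Lemma deg_bipl a : deg bip_graph (inl a) = \sum_b m a b.
Proof.
rewrite degE big_sumType /= big1 ?add0n => [|a' _]; last by rewrite adj_bip.
by apply: eq_bigr => b _; rewrite adj_bip.
Qed.

Lemma deg_bipr b : deg bip_graph (inr b) = \sum_a m a b.
Proof.
rewrite degE big_sumType /= addnC big1 ?add0n => [|a' _]; last by rewrite adj_bip.
by apply: eq_bigr => a _; rewrite adj_bip.
Qed.

Lemma triangle_free_bip : triangle_free bip_graph.
Proof.
apply/triangle_freeP => u v; rewrite adj_bip => uv.
apply/eqP; rewrite cards_eq0; apply/eqP/finset.setP => w; rewrite !inE !adj_bip.
by case: u v w uv => [a|b] [a'|b'] [a''|b''] //=; rewrite ?andbF.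
Qed.

End BipartiteGraph.

Lemma sum_ord_const n c : \sum_(i < n) c = n * c.
Proof. by rewrite sum_nat_const card_ord. Qed.

(** * Triangle-free graphs with degrees m and m + 1 *)

Section TwoDegrees.
Variables (T : finType) (G : sgraph T) (s : pred T) (m : nat).

(** A vertex of degree m + 1 contributes (m + 1) m (m - 1) = m^3 - m whatever its neighbours are. A
    vertex of degree m receives m^2 from each neighbour of degree m + 1 but m^2 - 1 from each of
    degree m. *)
Lemma two_degrees_Lambda : 0 < m -> #|T| = 3 * m + 1 -> triangle_free G ->
  (forall x, deg G x = if s x then m else m + 1) ->
  Lambda H4 G + m * (\sum_x ~~ s x) + \sum_x \sum_u [&& s x, s u & adj G x u]
  = #|T| * pi3 #|T|.-1.
Proof.
move=> m0 cardT tf dE; rewrite Lambda_vcount cardT.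
have -> : (3 * m + 1).-1 = 3 * m by lia.
rewrite pi3_0 big_distrr /= -!big_split /= -cardT -sum_nat_const.
apply: eq_bigr => x _; rewrite triangle_free_vcount // cardT dE.
case sx: (s x) => /=.
  have -> : \sum_u (s u && adj G x u) = \sum_(u | adj G x u) s u.
    by rewrite [RHS]big_mkcond; apply: eq_bigr => u _; case: adj; rewrite ?andbT ?andbF.
  rewrite muln0 addn0 -big_split /= (eq_bigr (fun=> m * m)).
    by rewrite sum_nbrs_const dE sx mulnA.
  move=> u _; rewrite dE; case: (s u) => /=.
    rewrite (_ : 3 * m + 1 - m - m = m + 1); last lia.
    by case: m m0 => // m' _; lia.
  by rewrite (_ : 3 * m + 1 - m - (m + 1) = m); lia.
rewrite muln1 [X in _ + _ + X]big1 // addn0 (eq_bigr (fun=> m * (m - 1))).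
  rewrite sum_nbrs_const dE sx; case: m m0 => // m' _; lia.
move=> u _; rewrite dE; case: (s u) => /=.
  by rewrite (_ : 3 * m + 1 - (m + 1) - m = m); lia.
rewrite (_ : 3 * m + 1 - (m + 1) - (m + 1) = m - 1); lia.
Qed.
End TwoDegrees.

Ltac sum_types := rewrite ?big_sumType /= ?sum_ord_const ?big1_eq ?muln0 ?muln1 ?add0n ?addn0.

Lemma regular_relation (A B : finType) r : #|A| = #|B| -> r <= #|B| ->
  exists e : A -> B -> bool,
    (forall a, \sum_b e a b = r) /\ (forall b, \sum_a e a b = r).
Proof.
move=> AB rB; apply: (@biregular_relation A B (fun=> r) r) => //.
by rewrite sum_nat_const AB.
Qed.

Lemma regular_relation_ord p r : r <= p ->
  exists e : 'I_p -> 'I_p -> bool,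
    (forall a, \sum_b e a b = r) /\ (forall b, \sum_a e a b = r).
Proof. by move=> rp; apply: regular_relation; rewrite ?card_ord. Qed.

(* Four classes: two cross pairs are complete, and the other two are joined
   by regular bipartite graphs. *)
Lemma two_degree_bipartite p q r1 r2 : r1 <= p -> r2 <= q ->
  exists (T : finType) (G : sgraph T) (s : pred T),
  [/\ #|T| = 2 * p + 2 * q, triangle_free G,
      forall x, deg G x = if s x then r1 + q else p + r2,
      \sum_x ~~ s x = 2 * q &
      \sum_x \sum_u [&& s x, s u & adj G x u] = 2 * p * r1].
Proof.
move=> /regular_relation_ord[e1 [row1 col1]] /regular_relation_ord[e2 [row2 col2]].
pose m (a b : 'I_p + 'I_q) := match a, b with
  | inl a, inl b => e1 a b | inr a, inr b => e2 a b | _, _ => true end.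
pose s (x : ('I_p + 'I_q) + ('I_p + 'I_q)) := match x with
  | inl (inl _) | inr (inl _) => true | _ => false end.
exists (('I_p + 'I_q) + ('I_p + 'I_q))%type, (bip_graph m), s; split.
- by rewrite !card_sum !card_ord; lia.
- exact: triangle_free_bip.
- case=> [[x|x]|[x|x]]; rewrite ?deg_bipl ?deg_bipr; sum_types => //.
  + by rewrite row1.
  + by rewrite row2.
  + by rewrite col1.
  + by rewrite col2.
- by sum_types; lia.
under eq_bigr => x _ do under eq_bigr => u _ do rewrite adj_bip.
sum_types.
under eq_bigr => x _ do sum_types.
under [X in _ + X]eq_bigr => x _ do sum_types.
rewrite (eq_bigr (fun=> r1)) // [X in _ + X](eq_bigr (fun=> r1)) // !sum_ord_const.
lia.
Qed.

(** The sides have 3k + 1 and 3k vertices. The first class of B is joined completely to the first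
    and third classes of A, and [e] fills in the rest with row lengths that complete the degrees.
    Two vertices of degree 2k are adjacent only between the two first classes. *)
Lemma odd_two_degree_bipartite k x : 0 < k -> x <= k ->
  exists (T : finType) (G : sgraph T) (s : pred T),
  [/\ #|T| = 6 * k + 1, triangle_free G,
      forall v, deg G v = if s v then 2 * k else 2 * k + 1,
      \sum_v ~~ s v = 2 * k + 2 * x &
      \sum_v \sum_u [&& s v, s u & adj G v u] = 2 * (2 * k - x) * (k - x)].
Proof.
move=> k0 xk; pose A := ('I_(2 * k - x) + 'I_(k + 1) + 'I_x)%type.
pose r (a : A) := match a with
  | inl (inl _) => k + x | inl (inr _) => 2 * k | inr _ => k + 1 + x end.
have [||e [row col]] := @biregular_relation A 'I_(x + 2 * k) r (2 * k + 1).
- by rewrite card_ord => -[[a|a]|a] /=; lia.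
- rewrite card_ord; sum_types.
  have [y Ey] : exists y, k = x + y by exists (k - x); lia.
  by subst k; rewrite (_ : 2 * (x + y) - x = x + 2 * y); [ring | lia].
pose B := ('I_(k - x) + 'I_(x + 2 * k))%type.
pose m (a : A) (b : B) := match a, b with
  | _, inr b => e a b | inl (inr _), inl _ => false | _, inl _ => true end.
pose s (v : A + B) := match v with
  | inl (inl _) | inr (inl _) => true | _ => false end.
exists (A + B)%type, (bip_graph m), s; split.
- by rewrite !card_sum !card_ord; lia.
- exact: triangle_free_bip.
- case=> [[[v|v]|v]|[v|v]]; rewrite ?deg_bipl ?deg_bipr; sum_types => //.
  + by rewrite row /=; lia.
  + by rewrite row /=; lia.
  + by lia.
  + by have := col v; sum_types.
- by sum_types; lia.
under eq_bigr => v _ do under eq_bigr => u _ do rewrite adj_bip.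
sum_types.
under eq_bigr => v _ do sum_types.
under [X in _ + X + _]eq_bigr => v _ do sum_types.
under [X in _ + X]eq_bigr => v _ do sum_types.
sum_types.
lia.
Qed.

(* A blow-up of the 5-cycle p A1 B2 A2 B1, with the pair (A2, B2) thinned out
   to a regular bipartite graph. *)
Lemma pentagon_blowup k q r : r <= q ->
  exists (T : finType) (G : sgraph T) (p : T),
  [/\ #|T| = 2 * k + 2 * q + 3, triangle_free G, deg G p = 2 * k + 2 &
      forall v, v != p -> deg G v = q + 1 \/ deg G v = k + 1 + r].
Proof.
move=> /regular_relation_ord[e [row col]].
pose T := (unit + (('I_(k + 1) + 'I_(k + 1)) + ('I_q + 'I_q)))%type.
pose E (u v : T) : bool := match u, v with
  | inl _, inr (inl _) | inr (inl _), inl _ => true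
  | inr (inl (inl _)), inr (inr (inr _)) | inr (inr (inr _)), inr (inl (inl _)) => true
  | inr (inl (inr _)), inr (inr (inl _)) | inr (inr (inl _)), inr (inl (inr _)) => true
  | inr (inr (inl a)), inr (inr (inr b)) | inr (inr (inr b)), inr (inr (inl a)) => e a b
  | _, _ => false end.
have adjE : adj (graph_of E) =2 E.
  apply: adj_graph_of.
    by case=> [?|[[?|?]|[?|?]]] [?|[[?|?]|[?|?]]].
  by case=> [?|[[?|?]|[?|?]]].
have degE' u : deg (graph_of E) u = \sum_v E u v.
  by rewrite degE; apply: eq_bigr => v _; rewrite adjE.
exists T, (graph_of E), (inl tt); split.
- by rewrite !card_sum !card_ord card_unit; lia.
- apply/triangle_freeP => u v; rewrite adjE => uv.
  apply/eqP; rewrite cards_eq0; apply/eqP/finset.setP => w; rewrite !inE !adjE.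
  by case: u v w uv => [?|[[?|?]|[?|?]]] [?|[[?|?]|[?|?]]] [?|[[?|?]|[?|?]]] //=; rewrite ?andbF.
- by rewrite degE'; sum_types; lia.
have sum_unit (F : unit -> nat) : \sum_u F u = F tt.
  by rewrite (bigD1 tt) //= big1 ?addn0 // => -[].
case=> [[]|[[v|v]|[v|v]]] // _; rewrite degE'; sum_types; rewrite ?sum_unit.
- by left; lia.
- by left; lia.
- by right; rewrite row; lia.
- by right; rewrite col; lia.
Qed.

(** * Exact values and lower bounds *)

Lemma Lambda_le_Lambda_max n (T : finType) (G : sgraph T) :
  #|T| = n -> Lambda H4 G <= Lambda_max H4 n.
Proof. by move=> <-; exact: Lambda_le_max. Qed.

Lemma Lambda_max_leq n B :
  (forall T (G : sgraph T), #|T| = n -> Lambda H4 G <= B) -> Lambda_max H4 n <= B.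
Proof. by move=> h; apply/bigmax_leqP => G _; apply: h; rewrite card_ord. Qed.

Lemma Lambda_max_upper n : Lambda_max H4 n <= n * pi3 n.-1.
Proof. by apply: Lambda_max_leq => T G <-; exact: Lambda_upper. Qed.

(** Even orders allow regular bipartite graphs. For n = 6k + 5 a blown-up 5-cycle replaces them, as
    a regular bipartite graph of positive degree has even order. *)
Lemma exists_regular_triangle_free n : 4 <= n -> n %% 6 \in [:: 0; 2; 5] ->
  exists (T : finType) (G : sgraph T),
  [/\ #|T| = n, triangle_free G & regular ((n + 2) %/ 3) G].
Proof.
move=> n4; rewrite !inE => nmod.
pose k := n %/ 6.
(* With q = 0 only the two classes joined by the r-regular relation remain. *)
have bip p r : r <= p -> exists (T : finType) (G : sgraph T),
    [/\ #|T| = 2 * p, triangle_free G & regular r G].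
  move=> rp; have [T [G [s [cT tf dG sG _]]]] := two_degree_bipartite rp (leqnn 0).
  exists T, G; split=> // [|x]; first by rewrite cT muln0 addn0.
  have : s x by apply: contraPT sG => nsx; rewrite (bigD1 x) //= nsx.
  by rewrite dG => ->; rewrite addn0.
have [n0|[n2|n5]] : n = 6 * k \/ n = 6 * k + 2 \/ n = 6 * k + 5 by lia.
- have -> : (n + 2) %/ 3 = 2 * k by lia.
  have -> : n = 2 * (3 * k) by lia.
  by apply: bip; lia.
- have -> : (n + 2) %/ 3 = 2 * k + 1 by lia.
  have -> : n = 2 * (3 * k + 1) by lia.
  by apply: bip; lia.
have -> : (n + 2) %/ 3 = 2 * k + 2 by lia.
(* For q = 2k + 1 and r = k + 1 both alternatives q + 1 and k + 1 + r equal 2k + 2. *)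
have rq : k + 1 <= 2 * k + 1 by lia.
have [T [G [p [cT tf dp dG]]]] := pentagon_blowup k rq.
exists T, G; split=> // [|x]; first lia.
by have [->|/dG] := eqVneq x p; lia.
Qed.

Lemma Lambda_max_regular n : 4 <= n -> n %% 6 \in [:: 0; 2; 5] ->
  Lambda_max H4 n = n * pi3 n.-1 /\
  forall (T : finType) (G : sgraph T), #|T| = n ->
    (Lambda H4 G = Lambda_max H4 n <->
     regular ((n + 2) %/ 3) G /\ triangle_free G).
Proof.
move=> n4 nmod; have [T0 [G0 [c0 tf0 reg0]]] := exists_regular_triangle_free n4 nmod.
have d2 : 2 <= (n + 2) %/ 3 by lia.
have iffG (T : finType) (G : sgraph T) : #|T| = n -> Lambda H4 G = n * pi3 n.-1 <->
    regular ((n + 2) %/ 3) G /\ triangle_free G.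
  move=> cT; have Td : #|T| = 3 * ((n + 2) %/ 3) \/ #|T| + 1 = 3 * ((n + 2) %/ 3).
    by move: nmod; rewrite !inE cT; lia.
  by have := Lambda_maxP G d2 Td; rewrite cT.
have maxE : Lambda_max H4 n = n * pi3 n.-1.
  apply/eqP; rewrite eqn_leq Lambda_max_upper /=.
  by rewrite -(proj2 (iffG _ _ c0) (conj reg0 tf0)) Lambda_le_Lambda_max.
by split=> // T G cT; rewrite maxE; exact (iffG T G cT).
Qed.

Lemma Lambda_max_near_regular n k : 4 <= n -> n = 6 * k + 3 ->
  Lambda_max H4 n + 2 * k = n * pi3 n.-1 /\
  forall (T : finType) (G : sgraph T), #|T| = n ->
    (Lambda H4 G = Lambda_max H4 n <->
     [/\ triangle_free G,
         #|[set u | deg G u == 2 * k + 1]%SET| = n.-1 &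
         #|[set u | deg G u == 2 * k + 2]%SET| = 1]).
Proof.
move=> n4 nk; have k0 : 0 < k by lia.
have sumD (T : finType) (G : sgraph T) : #|T| = n ->
    Lambda H4 G + \sum_x defect G x = n * pi3 n.-1.
  by move=> cT; rewrite -cT Lambda_defect.
have upper (T : finType) (G : sgraph T) : #|T| = n -> Lambda H4 G + 2 * k <= n * pi3 n.-1.
  move=> cT; rewrite -(sumD _ G cT) leq_add2l.
  (* A total defect below 2k would be within the budget, and then [near_regular] makes it equal to
     2k. *)
  rewrite leqNgt; apply/negP => lt.
  by have [p [_ _ _ E]] := near_regular (etrans cT nk) k0 (ltnW lt); rewrite E ltnn in lt.
have maxE : Lambda_max H4 n + 2 * k = n * pi3 n.-1.
  have rk : k <= 2 * k by lia.
  have [T [G [p [cT tf dp dG]]]] := pentagon_blowup k rk.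
  have cT' : #|T| = n by lia.
  have dx x : x != p -> deg G x = 2 * k + 1 by move=> /dG; lia.
  have := near_regular_Lambda (etrans cT' nk) tf dp dx; rewrite cT' => E.
  have := Lambda_le_Lambda_max G cT'.
  have : Lambda_max H4 n <= n * pi3 n.-1 - 2 * k; last lia.
  by apply: Lambda_max_leq => T' G' cT''; have := upper _ G' cT''; lia.
split=> // T G cT; split=> [E|[tf cd cd1]].
  have small : \sum_x defect G x <= 2 * k by have := sumD _ G cT; lia.
  have [p [dp dx tf _]] := near_regular (etrans cT nk) k0 small.
  have pE : [set u | deg G u == 2 * k + 2]%SET = [set p]%SET.
    apply/finset.setP => u; rewrite !inE.
    by have [->|/dx ->] := eqVneq u p; rewrite ?dp; lia.
  split=> //; last by rewrite pE cards1.
  have -> : [set u | deg G u == 2 * k + 1]%SET = (~: [set p])%SET.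
    apply/finset.setP => u; rewrite !inE.
    by have [->|/dx ->] := eqVneq u p; rewrite ?dp; lia.
  by have := cardsC [set p]%SET; rewrite cards1 cT; lia.
have [p pE] := cards1P (introT eqP cd1).
have dp : deg G p = 2 * k + 2.
  by apply/eqP; have := set11 p; rewrite -pE inE.
have dx x : x != p -> deg G x = 2 * k + 1.
  move=> xp; apply/eqP.
  have sub : [set u | deg G u == 2 * k + 1]%SET \subset (~: [set p])%SET.
    apply/fintype.subsetP => u; rewrite !inE => /eqP du; apply: contra_eq_neq du => ->.
    by rewrite dp; apply/eqP; lia.
  have cC : #|(~: [set p])%SET| = n.-1.
    by have := cardsC [set p]%SET; rewrite cards1 cT; lia.
  have /setP/(_ x) : [set u | deg G u == 2 * k + 1]%SET = (~: [set p])%SET.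
    by apply/eqP; rewrite eqEcard sub cd cC leqnn.
  by rewrite !inE xp.
have := near_regular_Lambda (etrans cT nk) tf dp dx; rewrite cT; lia.
Qed.

(** The construction loses 8k^2 - 2kx + 2x^2. This is least at x = k/2, where it equals 15/2 k^2; x
    is k/2 rounded down. *)
Lemma Lambda_max_lower_odd n k : 0 < k -> n = 6 * k + 1 ->
  exists2 U, 2 * U <= 15 * k ^ 2 + 1 & n * pi3 n.-1 <= Lambda_max H4 n + U.
Proof.
move=> k0 nk; have [x kx] : exists x, k = 2 * x \/ k = 2 * x + 1 by exists (k %/ 2); lia.
have xk : x <= k by lia.
have [T [G [s [cT tf dG sG pG]]]] := odd_two_degree_bipartite k0 xk.
exists (2 * k * (2 * k + 2 * x) + 2 * (2 * k - x) * (k - x)).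
  case: kx => kx.
    have -> : 2 * k - x = 3 * x by lia.
    have -> : k - x = x by lia.
    rewrite kx; lia.
  have -> : 2 * k - x = 3 * x + 2 by lia.
  have -> : k - x = x + 1 by lia.
  rewrite kx; lia.
have cT' : #|T| = 3 * (2 * k) + 1 by lia.
have m0 : 0 < 2 * k by lia.
have := two_degrees_Lambda m0 cT' tf dG; rewrite sG pG cT -nk => <-.
by rewrite addnA !leq_add2r Lambda_le_Lambda_max // nk.
Qed.

(** With p = 3k + 2 - x, q = x, r1 = 2k + 1 - x and r2 = x - k the loss is 2x^2 - (6k + 4)x + 12k^2
    + 14k + 4, which is least near x = 3k/2. *)
Lemma Lambda_max_lower_even n k : n = 6 * k + 4 ->
  exists2 U, 2 * U <= 15 * k ^ 2 + 16 * k + 14 & n * pi3 n.-1 <= Lambda_max H4 n + U.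
Proof.
move=> nk; have [y ky] : exists y, k = 2 * y \/ k = 2 * y + 1 by exists (k %/ 2); lia.
have [x xE] : exists x, (k = 2 * y /\ x = 3 * y) \/ (k = 2 * y + 1 /\ x = 3 * y + 1).
  by exists (3 * k %/ 2); lia.
have r1 : 2 * k + 1 - x <= 3 * k + 2 - x by lia.
have r2 : x - k <= x by lia.
have [T [G [s [cT tf dG sG pG]]]] := two_degree_bipartite r1 r2.
exists ((2 * k + 1) * (2 * x) + 2 * (3 * k + 2 - x) * (2 * k + 1 - x)).
  case: xE => -[kE xE].
    have -> : 3 * k + 2 - x = 3 * y + 2 by lia.
    have -> : 2 * k + 1 - x = y + 1 by lia.
    rewrite kE xE; lia.
  have -> : 3 * k + 2 - x = 3 * y + 4 by lia.
  have -> : 2 * k + 1 - x = y + 2 by lia.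
  rewrite kE xE; lia.
have cT' : #|T| = 3 * (2 * k + 1) + 1 by lia.
have m0 : 0 < 2 * k + 1 by lia.
have dG' v : deg G v = if s v then 2 * k + 1 else 2 * k + 1 + 1.
  by rewrite dG; case: (s v); lia.
have cTn : #|T| = n by lia.
have := two_degrees_Lambda m0 cT' tf dG'; rewrite sG pG cTn => <-.
by rewrite addnA !leq_add2r Lambda_le_Lambda_max.
Qed.

(** A crude bound uniform in all residues, used for the limit density: a loss of order n^2 is
    invisible against n^4. *)
Lemma Lambda_max_close n : 4 <= n -> n * pi3 n.-1 <= Lambda_max H4 n + 100 * n ^ 2.
Proof.
move=> n4.
have [nmod|[nmod|nmod]] : (n %% 6 \in [:: 0; 2; 5]) \/ (n %% 6 = 3 \/ (n %% 6 = 1 \/ n %% 6 = 4)).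
- by rewrite !inE; have := ltn_pmod n (isT : 0 < 6); lia.
- by have [-> _] := Lambda_max_regular n4 nmod; exact: leq_addr.
- have nk : n = 6 * (n %/ 6) + 3 by lia.
  have [<- _] := Lambda_max_near_regular n4 nk; rewrite leq_add2l; nia.
have [nk|nk] : n = 6 * (n %/ 6) + 1 \/ n = 6 * (n %/ 6) + 4 by lia.
  have k0 : 0 < n %/ 6 by lia.
  have [U HU hU] := Lambda_max_lower_odd k0 nk.
  apply: leq_trans hU _; rewrite leq_add2l.
  move: (n %/ 6) HU nk {nmod k0} => k HU nk; nia.
have [U HU hU] := Lambda_max_lower_even nk.
apply: leq_trans hU _; rewrite leq_add2l.
move: (n %/ 6) HU nk {nmod} => k HU nk; nia.
Qed.

Local Open Scope classical_set_scope.
Local Open Scope ring_scope.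

(** * The shortfall as a sum of nonnegative terms *)

Section Shortfall.
Variables (R : realFieldType) (T : finType) (G : sgraph T) (M : R).
Hypothesis cardT : #|T|%:R = 3 * M + 1 :> R.
Implicit Types u v x y z : T.

Definition excess x : R := (deg G x)%:R - M.

(** For adjacent x and u this is (Z - W) / 2 when n = 3M + 1. *)
Definition imbalance x u : R :=
  1 + (codeg G x u)%:R - excess u - excess x / 2.

Lemma sum_nbrsR x (c : R) : \sum_(u | adj G x u) c = (deg G x)%:R * c.
Proof. by rewrite sumr_const /deg cardsE mulr_natl. Qed.

Lemma excess_ltr x : excess x <= 2 * M.
Proof.
rewrite /excess lerBlDr; have : (deg G x)%:R + 1 <= #|T|%:R :> R.
  by rewrite natr1 ler_nat deg_lt_card.
by rewrite cardT; lra.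
Qed.

(** W Z is ((W + Z)/2)^2 minus the square of the imbalance, and (W + Z)/2 = M - a/2 with a the
    excess of x. What remains is M^3 - (M + a)(M - a/2)^2 = a^2 (3M - a)/4. *)
Lemma vcount_shortfall x : M ^+ 3 - (vcount G x)%:R =
  excess x ^+ 2 * (3 * M - excess x) / 4 + \sum_(u | adj G x u) imbalance x u ^+ 2.
Proof.
have key : (vcount G x)%:R + \sum_(u | adj G x u) imbalance x u ^+ 2 =
    (deg G x)%:R * (M - excess x / 2) ^+ 2.
  rewrite -sum_nbrsR /vcount natr_sum -big_split /=; apply: eq_bigr => u xu.
  have W : (private_nbrs G x u)%:R = (deg G u)%:R - 1 - (codeg G x u)%:R :> R.
    by rewrite -(private_nbrsE xu) !natrD; ring.
  have Z : (common_nonnbrs G x u)%:R =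
      3 * M - (deg G x)%:R - (private_nbrs G x u)%:R :> R.
    have := common_nonnbrsE xu => /(congr1 (fun k => k%:R : R)).
    by rewrite !natrD cardT; lra.
  by rewrite natrM Z W /imbalance /excess; field.
have -> : \sum_(u | adj G x u) imbalance x u ^+ 2 =
    (deg G x)%:R * (M - excess x / 2) ^+ 2 - (vcount G x)%:R by rewrite -key; ring.
by rewrite /excess; field.
Qed.

Lemma Lambda_shortfall : #|T|%:R * M ^+ 3 - (Lambda H4 G)%:R =
  \sum_x excess x ^+ 2 * (3 * M - excess x) / 4 +
  \sum_x \sum_(u | adj G x u) imbalance x u ^+ 2.
Proof.
rewrite -big_split /= (eq_bigr (fun x => M ^+ 3 - (vcount G x)%:R)).
  by rewrite sumrB sumr_const mulr_natl Lambda_vcount natr_sum.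
by move=> x _; rewrite vcount_shortfall.
Qed.

Lemma sum_nbrs_sym (f : T -> T -> R) :
  \sum_x \sum_(u | adj G x u) f x u = \sum_x \sum_(u | adj G x u) f u x.
Proof.
rewrite (exchange_big_dep xpredT) //=; apply: eq_bigr => x _.
by apply: eq_bigl => u; rewrite adjC.
Qed.

(** Since each excess is at most 2M, the factor 3M - a is at least M. *)
Lemma sum_excess_le : 0 <= M ->
  M / 4 * \sum_x excess x ^+ 2 <= #|T|%:R * M ^+ 3 - (Lambda H4 G)%:R.
Proof.
move=> M0; rewrite Lambda_shortfall mulr_sumr ler_wpDr //.
  by apply: sumr_ge0 => x _; apply: sumr_ge0 => u _; exact: sqr_ge0.
apply: ler_sum => x _; have := excess_ltr x; have := sqr_ge0 (excess x).
move: (excess x) (excess x ^+ 2) => a b; nra.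
Qed.

Lemma sum_imbalance_le : 0 <= M ->
  \sum_x \sum_(u | adj G x u) imbalance x u ^+ 2 <= #|T|%:R * M ^+ 3 - (Lambda H4 G)%:R.
Proof.
move=> M0; rewrite Lambda_shortfall ler_wpDl //.
apply: sumr_ge0 => x _; have := excess_ltr x; have := sqr_ge0 (excess x).
move: (excess x) (excess x ^+ 2) => a b; nra.
Qed.

End Shortfall.

(** * Orders 3m + 1: every edge has a cost *)

Lemma edge_cost_ge1 (a b e : int) : 1 <= e ->
  1 <= a ^+ 2 + b ^+ 2 + (a + b - e) * (a + b - 2 * e).
Proof.
(* Twice the right-hand side is (a - b)^2 + 3 (a + b - e)^2 + e^2 > 0, and a positive integer is at
   least 1. Over the reals the minimum for e = 1 is only 1/2. *)
move=> e1; have : 0 <= (a - b) ^+ 2 by exact: sqr_ge0.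
have : 0 <= (a + b - e) ^+ 2 by exact: sqr_ge0.
nia.
Qed.

Section EdgeCount.
Variables (R : realFieldType) (T : finType) (G : sgraph T) (m : nat).
Hypothesis cardT : #|T| = (3 * m + 1)%N.
Implicit Types u v x y z : T.

Local Notation M := (m%:R : R).
Local Notation a := (excess G M).

Let cardTR : #|T|%:R = 3 * M + 1 :> R.
Proof. by rewrite cardT natrD natrM. Qed.

(* Half-edge weights: vertices of large excess pay for all their edges. *)
Let g x : R := if `|a x| < 4 then 3 / 4 * a x ^+ 2 else 1.

Let g_ge0 x : 0 <= g x.
Proof. by rewrite /g; case: ifP => // _; have := sqr_ge0 (a x); lra. Qed.

(** For small excess a the two sides differ by a^3 <= 4^3 = 64. For |a| >= 4, a^2 >= 16 and a <= 2M
    give M + a <= 4 (3M - a). *)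
Let vertex_cost x : (deg G x)%:R * g x <= a x ^+ 2 * (3 * M - a x) / 4 + 64.
Proof.
have -> : (deg G x)%:R = M + a x by rewrite /excess; ring.
have M0 : 0 <= M by rewrite ler0n.
have := excess_ltr G cardTR x; rewrite /g; case: ifP => [|/negbT].
  rewrite ltr_norml; move: (a x) => b /andP[b1 b2] _.
  suff : b ^+ 3 <= 64 by nra.
  have [b0|b0] := lerP b 0; first by nra.
  by nra.
rewrite -leNgt; move: (a x) => b b4 b2.
have : 16 <= b ^+ 2 by rewrite -real_normK ?num_real //; nra.
move: (b ^+ 2) => c c16; nra.
Qed.

(** An end of large excess pays 1 by itself. Otherwise the four terms add up to the form in
    [edge_cost_ge1] with e = 1 + codegree, at integral excesses because M is an integer. *)
Let edge_cost x u : adj G x u ->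
  1 <= g x + imbalance G M x u ^+ 2 + (g u + imbalance G M u x ^+ 2).
Proof.
move=> xu; have := g_ge0 x; have := g_ge0 u.
have := sqr_ge0 (imbalance G M x u); have := sqr_ge0 (imbalance G M u x).
case xs: (`|a x| < 4); last by rewrite [g x]/g xs; lra.
case us: (`|a u| < 4); last by rewrite [g u]/g us; lra.
move=> _ _ _ _; rewrite /g xs us; rewrite /imbalance (codegC G u x).
pose za x := (deg G x)%:Z - m%:Z; pose e := (codeg G x u)%:Z + 1.
have e1 : 1 <= e by rewrite /e; lia.
have := edge_cost_ge1 (za x) (za u) e1; rewrite -(ler1z R).
rewrite /za /e !(rmorphD, rmorphB, rmorphM, rmorphXn) /= /excess -!pmulrn.
nra.
Qed.

Lemma half_edges_le :
  (\sum_x (deg G x)%:R) / 2 <=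
  #|T|%:R * M ^+ 3 - (Lambda H4 G)%:R + 64 * #|T|%:R :> R.
Proof.
rewrite (Lambda_shortfall G cardTR).
pose D := \sum_x \sum_(u | adj G x u) (g x + imbalance G M x u ^+ 2).
have D1 : D <= \sum_x a x ^+ 2 * (3 * M - a x) / 4 +
    \sum_x \sum_(u | adj G x u) imbalance G M x u ^+ 2 + 64 * #|T|%:R.
  have -> : 64 * #|T|%:R = \sum_(x : T) 64 :> R by rewrite sumr_const mulr_natr.
  rewrite /D -!big_split /=; apply: ler_sum => x _.
  rewrite big_split /= sum_nbrsR; have := vertex_cost x; lra.
apply: le_trans D1; rewrite ler_pdivrMr // mulr_natr mulr2n.
rewrite {1}/D sum_nbrs_sym -big_split /=; apply: ler_sum => x _.
rewrite -big_split /= -[X in X <= _]mulr1 -sum_nbrsR; apply: ler_sum => u xu.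
by have := edge_cost xu; lra.
Qed.

(** The shortfall is at least the number of edges minus O(n). Were it below the bound, the sum S of
    squared excesses would be at most 6M, leaving at least 3/2 M^2 - O(M) edges. *)
Lemma unbalanced_shortfall : (0 < m)%N ->
  3 / 2 * M ^+ 2 - 200 * M <= #|T|%:R * M ^+ 3 - (Lambda H4 G)%:R.
Proof.
move=> m0; have M1 : 1 <= M by rewrite ler1n.
have := half_edges_le; have := sum_excess_le G cardTR (ler0n R m).
set D := (_ - _); set S := \sum_x a x ^+ 2 => h1 h2.
have : (3 * M + 1) * M - S <= \sum_x (deg G x)%:R.
  have -> : (3 * M + 1) * M = \sum_(x : T) M by rewrite -cardTR sumr_const mulr_natl.
  rewrite -sumrB; apply: ler_sum => x _.
  have -> : (deg G x)%:R = M + a x by rewrite /excess; ring.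
  (* This uses integrality: a negative excess is at most -1. *)
  have : - a x <= a x ^+ 2.
    rewrite /excess; have [h|h] := leqP m (deg G x).
      have := sqr_ge0 ((deg G x)%:R - M); have : M <= (deg G x)%:R by rewrite ler_nat. lra.
    have : (deg G x)%:R + 1 <= M by rewrite natr1 ler_nat.
    by nra.
  lra.
rewrite cardTR in h2 => h3.
have S0 : 0 <= S by apply: sumr_ge0 => x _; exact: sqr_ge0.
have [|DM] := lerP (3 / 2 * M ^+ 2 - 200 * M) D => //.
have : S <= 6 * M by nra.
nra.
Qed.

End EdgeCount.

(** The two residues modulo 6 correspond to m = 2k and m = 2k + 1; in both cases 3/2 m^2 >= 6k^2 and
    200 m <= 600 k. *)
Lemma Lambda_max_upper_unbalanced n k m : (0 < k)%N -> n = (3 * m + 1)%N ->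
  (2 * k <= m <= 2 * k + 1)%N ->
  (Lambda_max H4 n + 6 * k ^ 2 <= n * pi3 n.-1 + 600 * k)%N.
Proof.
move=> k0 nm /andP[mk1 mk2].
have [G _ ->] : {G : sgraph 'I_n | true & Lambda_max H4 n = Lambda H4 G}.
  by apply: eq_bigmax_cond; apply/card_gt0P; exists (graph_of (fun _ _ => false)).
have cT : #|'I_n| = (3 * m + 1)%N by rewrite card_ord.
have m0 : (0 < m)%N by lia.
have := @unbalanced_shortfall rat _ G m cT m0; rewrite card_ord.
have -> : n.-1 = (3 * m)%N by lia.
rewrite pi3_0 -(ler_nat rat) => h.
have -> : (Lambda H4 G + 6 * k ^ 2)%:R = (Lambda H4 G)%:R + 6 * k%:R ^+ 2 :> rat.
  by rewrite natrD [in LHS]natrM natrX.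
have -> : (n * (m * m * m) + 600 * k)%:R = n%:R * m%:R ^+ 3 + 600 * k%:R :> rat.
  have mmm : (m * m * m)%:R = m%:R ^+ 3 :> rat by rewrite 2!natrM; ring.
  by rewrite natrD (natrM _ n) mmm (natrM _ 600).
have h1 : 2 * k%:R <= m%:R :> rat by rewrite -natrM ler_nat.
have h2 : m%:R <= 2 * k%:R + 1 :> rat by rewrite -natrM natr1 ler_nat -addn1.
have h3 : 1 <= k%:R :> rat by rewrite ler1n.
nra.
Qed.

(** * Degree variance and codegree total compared with the shortfall *)

Section Quantities.
Variables (R : realFieldType) (T : finType) (G : sgraph T).
Implicit Types u v x y z : T.

Local Notation n := (#|T|%:R : R).
Definition third : R := (n - 1) / 3.
Definition shortfall : R := n * third ^+ 3 - (Lambda H4 G)%:R.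
Definition deg_variance : R := \sum_x excess G third x ^+ 2.
Definition codeg_total : R := \sum_x \sum_(u | adj G x u) (codeg G x u)%:R.

Hypothesis cardT : (2 <= #|T|)%N.

Let n2 : 2 <= n. Proof. by rewrite ler_nat. Qed.
Let cardTR : n = 3 * third + 1. Proof. by rewrite /third; field. Qed.
Let third_ge0 : 0 <= third. Proof. by have := cardTR; have := n2; lra. Qed.

Lemma deg_variance_ge0 : 0 <= deg_variance.
Proof. by apply: sumr_ge0 => x _; exact: sqr_ge0. Qed.

(** The factor [third] / 4 of [sum_excess_le] is at least n / 24, because n >= 2. *)
Lemma deg_variance_le : n * deg_variance <= 24 * shortfall.
Proof.
have := sum_excess_le G cardTR third_ge0; rewrite -/deg_variance -/shortfall.
have := deg_variance_ge0; have := cardTR; have := n2.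
move: deg_variance shortfall third n => a d t N.
nra.
Qed.

Lemma shortfall_ge0 : 0 <= shortfall.
Proof.
by have := deg_variance_le; have := mulr_ge0 (ler0n R #|T|) deg_variance_ge0; lra.
Qed.

Lemma sum_pairs_le (f : T -> T -> R) : (forall x u, 0 <= f x u) ->
  \sum_x \sum_(u | adj G x u) f x u <= \sum_x \sum_u f x u.
Proof.
move=> f0; apply: ler_sum => x _; rewrite [X in X <= _]big_mkcond; apply: ler_sum => u _.
by case: ifP.
Qed.

Let sum_constT (c : R) : \sum_(x : T) c = n * c.
Proof. by rewrite sumr_const mulr_natl. Qed.

Lemma sum_pair_weights :
  \sum_x \sum_(u | adj G x u) (1 + excess G third u ^+ 2 + excess G third x ^+ 2 / 4)
  <= n ^+ 2 + 5 / 4 * (n * deg_variance).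
Proof.
apply: le_trans (sum_pairs_le _) _ => [x u|].
  by have := sqr_ge0 (excess G third u); have := sqr_ge0 (excess G third x); lra.
rewrite (eq_bigr (fun x => n + deg_variance + n * (excess G third x ^+ 2 / 4))); last first.
  by move=> x _; rewrite !big_split /= !sum_constT mulr1.
rewrite !big_split /= !sum_constT -mulr_sumr -mulr_suml -/deg_variance.
lra.
Qed.

(** The codegree is the imbalance minus 1 plus the excess of u plus half that of x; the square of
    four summands is at most 4 times the sum of their squares. *)
Lemma codeg_sqr_sum_le :
  \sum_x \sum_(u | adj G x u) (codeg G x u)%:R ^+ 2 <=
  4 * (shortfall + n ^+ 2 + 5 / 4 * (n * deg_variance)) :> R.
Proof.
have h1 := sum_imbalance_le G cardTR third_ge0; rewrite -/shortfall in h1.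
have h2 := sum_pair_weights.
apply: (@le_trans _ _ (4 * (\sum_x \sum_(u | adj G x u) imbalance G third x u ^+ 2 +
  \sum_x \sum_(u | adj G x u) (1 + excess G third u ^+ 2 + excess G third x ^+ 2 / 4)))).
  rewrite -big_split mulr_sumr /=; apply: ler_sum => x _.
  rewrite -big_split mulr_sumr /=; apply: ler_sum => u _.
  rewrite /imbalance; move: (excess G third x) (excess G third u) ((codeg G x u)%:R) => a b c.
  have := sqr_ge0 (b + a / 2 + 2 * 1 - (1 + c - b - a / 2)).
  set y := 1 + c - b - a / 2; have -> : c = y - 1 + b + a / 2 by rewrite /y; ring.
  move: y => y _.
  have := sqr_ge0 (y + 1); have := sqr_ge0 (y - b); have := sqr_ge0 (y - a / 2).
  have := sqr_ge0 (1 + b); have := sqr_ge0 (1 + a / 2); have := sqr_ge0 (b - a / 2).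
  lra.
lra.
Qed.

Lemma codeg_le_card x u : (codeg G x u <= #|T|)%N.
Proof. exact: max_card. Qed.

(** An excess is at least -M, so 3M - a <= 4M. The squared imbalance is split into four squares, and
    a squared codegree is at most n times the codegree. *)
Lemma shortfall_le :
  shortfall <= 6 * (n * deg_variance) + 4 * (n * codeg_total) + 4 * n ^+ 2.
Proof.
rewrite /shortfall (Lambda_shortfall G cardTR).
have h1 : \sum_x excess G third x ^+ 2 * (3 * third - excess G third x) / 4 <= third * deg_variance.
  rewrite mulr_sumr; apply: ler_sum => x _.
  have : - third <= excess G third x by rewrite /excess lerBrDr addNr.
  have := sqr_ge0 (excess G third x).
  move: (excess G third x) (excess G third x ^+ 2) => a b; nra.
have h2 := sum_pair_weights.
have h3 : \sum_x \sum_(u | adj G x u) imbalance G third x u ^+ 2 <=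
   4 * (n * codeg_total + \sum_x \sum_(u | adj G x u) (1 + excess G third u ^+ 2 + excess G third x ^+ 2 / 4)).
  rewrite /codeg_total mulr_sumr -big_split mulr_sumr /=; apply: ler_sum => x _.
  rewrite mulr_sumr -big_split mulr_sumr /=; apply: ler_sum => u _.
  have : (codeg G x u)%:R ^+ 2 <= n * (codeg G x u)%:R :> R.
    by rewrite expr2 ler_wpM2r // ler_nat codeg_le_card.
  rewrite /imbalance; move: (excess G third x) (excess G third u) ((codeg G x u)%:R) => a b c.
  have := sqr_ge0 (c - 1); have := sqr_ge0 (c + b); have := sqr_ge0 (c + a / 2).
  have := sqr_ge0 (1 + b); have := sqr_ge0 (1 + a / 2); have := sqr_ge0 (b - a / 2).
  lra.
have := deg_variance_ge0; have := cardTR; have := third_ge0; nra.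
Qed.

Lemma card_triangles_le_codeg : #|triangles G|%:R <= codeg_total.
Proof.
have -> : codeg_total = (\sum_x \sum_(u | adj G x u) codeg G x u)%N%:R.
  by rewrite natr_sum; apply: eq_bigr => x _; rewrite natr_sum.
by rewrite sum_codeg ler_nat card_triangles_le.
Qed.

Lemma codeg_le_card_triangles : codeg_total <= 27 * #|triangles G|%:R.
Proof.
have -> : codeg_total = (\sum_x \sum_(u | adj G x u) codeg G x u)%N%:R.
  by rewrite natr_sum; apply: eq_bigr => x _; rewrite natr_sum.
by rewrite sum_codeg mulrC -natrM ler_nat card_ordered_triangles_le.
Qed.

(** The shortfall controls squares of codegrees; c <= eps n + c^2 / (eps n) passes to the codegrees
    themselves. *)
Lemma codeg_total_le (eps : R) : 0 < eps ->
  codeg_total <= eps * n ^+ 3 +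
    (4 * (shortfall + n ^+ 2 + 5 / 4 * (n * deg_variance))) / (eps * n).
Proof.
move=> e0; have n0 : 0 < n by have := n2; lra.
have en0 : 0 < eps * n by rewrite mulr_gt0.
apply: (@le_trans _ _ (\sum_x \sum_(u | adj G x u) (eps * n + (codeg G x u)%:R ^+ 2 / (eps * n)))).
  apply: ler_sum => x _; apply: ler_sum => u _.
  have c0 : 0 <= (codeg G x u)%:R :> R by [].
  move: ((codeg G x u)%:R) (eps * n) en0 c0 => c d d0 c0.
  rewrite -(ler_pM2r d0) mulrDl divfK ?gt_eqF //.
  have := sqr_ge0 (c - d); have := mulr_ge0 c0 (ltW d0); lra.
under eq_bigr do rewrite big_split /=.
rewrite big_split /=; apply: lerD; last first.
  under eq_bigr do rewrite -mulr_suml.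
  by rewrite -mulr_suml ler_pM2r ?invr_gt0 // codeg_sqr_sum_le.
apply: le_trans (sum_pairs_le _) _ => [x u|]; first exact: ltW.
under eq_bigr do rewrite sum_constT.
by rewrite sum_constT; lra.
Qed.

End Quantities.

(** * Density and stability *)

Lemma ffact4E (R : realFieldType) n : (3 <= n)%N ->
  (n ^_ 4)%:R = n%:R * (n%:R - 1) * (n%:R - 2) * (n%:R - 3) :> R.
Proof.
move=> n3; have [k ->] : exists k, n = k.+3 by exists (n - 3)%N; lia.
by rewrite !ffactnS /= ffactn0 !natrM -!(natr1 k.+2) -!(natr1 k.+1) -!(natr1 k); ring.
Qed.

Section DensityDistance.
Variables (R : realFieldType) (N P L D : R).
Hypotheses (N6 : 6 <= N) (PE : P = N * (N - 1) * (N - 2) * (N - 3)).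

Let N_ge0 : 0 <= N. Proof. by have := N6; lra. Qed.

Let P_le : P <= N ^+ 4.
Proof.
rewrite PE; move: N N6 => x x6.
have -> : x * (x - 1) * (x - 2) * (x - 3) = x * ((x - 1) * (x - 2) * (x - 3)) by ring.
rewrite [x ^+ 4]exprS ler_pM2l; last lra.
nra.
Qed.

Let P_ge : N ^+ 4 <= 4 * P.
Proof.
rewrite PE; move: N N6 => x x6.
have -> : 4 * (x * (x - 1) * (x - 2) * (x - 3)) = x * (4 * ((x - 1) * (x - 2) * (x - 3))) by ring.
rewrite [x ^+ 4]exprS ler_pM2l; last lra.
have -> : x ^+ 3 = x * x ^+ 2 by ring.
have h1 : x ^+ 2 <= 3 * ((x - 2) * (x - 3)) by nra.
have h2 : x <= 6 / 5 * (x - 1) by lra.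
have h3 : 0 <= x ^+ 2 by exact: sqr_ge0.
have : x * x ^+ 2 <= 6 / 5 * (x - 1) * x ^+ 2 by rewrite ler_wpM2r.
have : 6 / 5 * (x - 1) * x ^+ 2 <= 6 / 5 * (x - 1) * (3 * ((x - 2) * (x - 3))).
  by rewrite ler_wpM2l //; lra.
have : 0 <= (x - 1) * ((x - 2) * (x - 3)) by rewrite !mulr_ge0 //; lra.
lra.
Qed.

Let P_gt0 : 0 < P.
Proof.
have := P_ge; have : 0 < N ^+ 4 by rewrite exprn_gt0 //; have := N6; lra.
lra.
Qed.

Hypothesis D0 : 0 <= D.
Hypothesis LD : N * ((N - 1) / 3) ^+ 3 - L = D.

(** N (N - 1)^3 exceeds the falling factorial P by N (N - 1)(3N - 5), which is only cubic in N. *)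
Let gap : P - 27 * L = 27 * D - N * (N - 1) * (3 * N - 5).
Proof. by rewrite -LD PE; field. Qed.

Let corr_ge0 : 0 <= N * (N - 1) * (3 * N - 5).
Proof. by move: N N6 => x x6; rewrite !mulr_ge0 //; lra. Qed.

Let corr_le : N * (N - 1) * (3 * N - 5) <= 3 * N ^+ 3.
Proof. move: N N6 => x x6; nra. Qed.

Let distE : `|1 / 27 - L / P| = `|P - 27 * L| / (27 * P).
Proof.
have P0 := P_gt0.
have -> : 1 / 27 - L / P = (P - 27 * L) / (27 * P) by field; rewrite gt_eqF.
by rewrite normrM normfV (gtr0_norm (x := 27 * P)) // mulr_gt0.
Qed.

Lemma density_dist_le e : D <= e / 8 * N ^+ 4 -> 3 <= e * N ->
  `|1 / 27 - L / P| <= e.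
Proof.
move=> De eN; rewrite distE ler_pdivrMr ?mulr_gt0 ?P_gt0 // gap.
have N3 : 0 <= N ^+ 3 by rewrite exprn_ge0.
have h : 3 * N ^+ 3 <= e * N ^+ 4.
  by have := ler_wpM2r N3 eN; rewrite [N ^+ 4]exprS; lra.
have e0 : 0 < e by have := N6; nra.
have h1 := ler_wpM2l (ltW e0) P_ge; have h2 := mulr_ge0 (ltW e0) (ltW P_gt0).
have h3 := corr_ge0; have h4 := corr_le; have h5 := D0; rewrite ler_norml.
by apply/andP; split; lra.
Qed.

Lemma shortfall_le_dist e : `|1 / 27 - L / P| <= e -> 1 <= 9 * (e * N) ->
  D <= 2 * e * N ^+ 4.
Proof.
rewrite distE ler_pdivrMr ?mulr_gt0 ?P_gt0 // gap => h eN.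
have N3 : 0 <= N ^+ 3 by rewrite exprn_ge0.
have h' : N ^+ 3 <= 9 * (e * N ^+ 4).
  by have := ler_wpM2r N3 eN; rewrite mul1r [N ^+ 4]exprS; lra.
have e0 : 0 < e by have := N6; nra.
have := ler_wpM2l (ltW e0) P_le.
by have := corr_le; move: h; rewrite ler_norml => /andP[]; lra.
Qed.

End DensityDistance.

Section Stability.
Variables (R : realType) (T : nat -> finType) (G : forall i, sgraph (T i)).
Hypothesis T_oo : #|T i| @[i --> \oo] --> \oo.

Local Notation n i := (#|T i|%:R : R).

(** This is s = o(n^d); one side suffices, as it is applied to quantities that are eventually
    nonnegative. *)
Definition negligible (d : nat) (s : nat -> R) :=
  forall eps : R, 0 < eps -> \forall i \near \oo, s i <= eps * n i ^+ d.

Lemma card_near (r : R) : \forall i \near \oo, r <= n i.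
Proof.
have : \forall i \near \oo, (Num.bound `|r| <= #|T i|)%N.
  by move/cvgnyPge: T_oo; apply.
apply: filterS => i h; apply: le_trans (ler_norm r) _.
by apply: le_trans (ltW (archi_boundP (normr_ge0 r))) _; rewrite ler_nat.
Qed.

Lemma card_nearN (k : nat) : \forall i \near \oo, (k <= #|T i|)%N.
Proof. by move/cvgnyPge: T_oo; apply. Qed.

Lemma lambda_cvgP : (lambda R H4 (G i) @[i --> \oo] --> (1 / 27 : R)) <->
  negligible 4 (fun i => shortfall R (G i)).
Proof.
rewrite cvgrPdist_le; split=> h e e0.
  have e2 : 0 < e / 2 by lra.
  apply: filterS3 (h _ e2) (card_near (2 / (9 * e))) (card_nearN 6) => i /= hi ni n6.
  have N6 : 6 <= n i by rewrite ler_nat.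
  have n3 : (3 <= #|T i|)%N by rewrite (leq_trans _ n6).
  have := @shortfall_le_dist _ _ _ (Lambda H4 (G i))%:R (shortfall R (G i)) N6 (ffact4E R n3) erefl (e / 2).
  rewrite /lambda card_ord in hi; move=> /(_ hi).
  rewrite (_ : 2 * (e / 2) = e); last lra.
  by apply; move: ni; rewrite ler_pdivrMr; lra.
have e8 : 0 < e / 8 by lra.
apply: filterS3 (h _ e8) (card_near (3 / e)) (card_nearN 6) => i /= hi ni n6.
rewrite /lambda card_ord.
have N6 : 6 <= n i by rewrite ler_nat.
have n3 : (3 <= #|T i|)%N by rewrite (leq_trans _ n6).
apply: (@density_dist_le _ _ _ _ (shortfall R (G i)) N6 (ffact4E R n3) (shortfall_ge0 R (G i) (ltnW n3)) erefl) => //.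
by move: ni; rewrite ler_pdivrMr // mulrC.
Qed.

Lemma negligible_deg_variance : negligible 4 (fun i => shortfall R (G i)) ->
  negligible 3 (fun i => deg_variance R (G i)).
Proof.
move=> h e e0; have e24 : 0 < e / 24 by lra.
apply: filterS2 (h _ e24) (card_nearN 2) => i /= hi n2.
have n0 : 0 < n i by rewrite ltr0n (leq_trans _ n2).
rewrite -(ler_pM2l n0); apply: le_trans (deg_variance_le R (G i) n2) _.
have -> : n i * (e * n i ^+ 3) = e * n i ^+ 4 by ring.
lra.
Qed.

Lemma negligible_codeg : negligible 4 (fun i => shortfall R (G i)) ->
  negligible 3 (fun i => codeg_total R (G i)).
Proof.
move=> h e e0; have e2 : 0 < e / 2 by lra.
(* By [deg_variance_le] the bracket below is at most 31 times the shortfall plus n^2, and 124/1000 +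
   4/1600 < 1/4. *)
have es : 0 < e ^+ 2 / 1000 by apply: divr_gt0; rewrite ?ltr0n // exprn_gt0.
apply: filterS3 (h _ es) (card_near (40 / e)) (card_nearN 2) => i /= hi ni n2.
have n0 : 0 < n i by rewrite ltr0n (leq_trans _ n2).
apply: (le_trans (codeg_total_le (G i) n2 e2)).
suff : 4 * (shortfall R (G i) + n i ^+ 2 + 5 / 4 * (n i * deg_variance R (G i))) / (e / 2 * n i)
   <= e / 2 * n i ^+ 3 by lra.
rewrite ler_pdivrMr ?mulr_gt0 //.
have h1 := deg_variance_le R (G i) n2.
have h2 : 40 <= e * n i by move: ni; rewrite ler_pdivrMr // mulrC.
have h3 : 1600 * n i ^+ 2 <= e ^+ 2 * n i ^+ 4.
  have -> : e ^+ 2 * n i ^+ 4 = (e * n i) ^+ 2 * n i ^+ 2 by ring.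
  rewrite ler_wpM2r ?sqr_ge0 //; move: (e * n i) h2 => x x40; nra.
have -> : e / 2 * n i ^+ 3 * (e / 2 * n i) = e ^+ 2 * n i ^+ 4 / 4 by field.
have := sqr_ge0 (n i); lra.
Qed.

Lemma negligible_shortfall : negligible 3 (fun i => deg_variance R (G i)) ->
  negligible 3 (fun i => codeg_total R (G i)) ->
  negligible 4 (fun i => shortfall R (G i)).
Proof.
(* Each of the three terms of [shortfall_le] receives a third of e. *)
move=> hA hC e e0; have e18 : 0 < e / 18 by lra. have e12 : 0 < e / 12 by lra.
apply: filterS3 (filterI (hA _ e18) (hC _ e12)) (card_near (12 / e)) (card_nearN 2).
move=> i /= [h1 h2] ni n2; have n0 : 0 < n i by rewrite ltr0n (leq_trans _ n2).
apply: le_trans (shortfall_le R (G i) n2) _.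
have h3 : 12 <= e * n i by move: ni; rewrite ler_pdivrMr // mulrC.
have h4 : 12 * n i ^+ 2 <= e * n i ^+ 4.
  have -> : e * n i ^+ 4 = (e * n i) * n i ^+ 2 * n i by ring.
  have n1 : 1 <= n i by rewrite ler1n (leq_trans _ n2).
  have : 12 * n i ^+ 2 <= e * n i * n i ^+ 2 by rewrite ler_wpM2r ?sqr_ge0.
  have : 0 <= n i ^+ 2 by exact: sqr_ge0.
  move: (n i ^+ 2) (e * n i) (n i) h3 n1 => a b c b12 c1 a0; nra.
have := ler_wpM2l (ltW n0) h1; have := ler_wpM2l (ltW n0) h2; lra.
Qed.

Lemma triangle_density_cvgP :
  (triangle_density R (G i) @[i --> \oo] --> (0 : R)) <->
  negligible 3 (fun i => codeg_total R (G i)).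
Proof.
have binE i : (4 <= #|T i|)%N -> 'C(#|T i|, 3)%:R = n i * (n i - 1) * (n i - 2) / 6 :> R.
  move=> n4; have [k ->] : exists k, #|T i| = k.+2 by exists (#|T i| - 2)%N; lia.
  have := bin_ffact k.+2 3; rewrite !ffactnS ffactn0 /= => /(congr1 (fun k => k%:R : R)).
  rewrite !natrM -!(natr1 k.+1) -!(natr1 k) => E.
  by lra.
rewrite cvgrPdist_le; split=> h e e0.
  have e27 : 0 < e / 27 by lra.
  apply: filterS2 (h _ e27) (card_nearN 4) => i /= + n4.
  have n0 : 4 <= n i by rewrite ler_nat.
  rewrite /triangle_density sub0r normrN ger0_norm ?divr_ge0 // binE // ler_pdivrMr; last first.
    by rewrite divr_gt0 // !mulr_gt0 //; lra.
  move=> hi; apply: le_trans (codeg_le_card_triangles R (G i)) _.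
  suff : n i * (n i - 1) * (n i - 2) / 6 <= n i ^+ 3.
    by move=> /(ler_wpM2l (ltW e27)); lra.
  move: (n i) n0 => x x4; nra.
have e48 : 0 < e / 48 by lra.
apply: filterS2 (h _ e48) (card_nearN 4) => i /= hi n4.
have n0 : 4 <= n i by rewrite ler_nat.
rewrite /triangle_density sub0r normrN ger0_norm ?divr_ge0 // binE // ler_pdivrMr; last first.
  by rewrite divr_gt0 // !mulr_gt0 //; lra.
apply: le_trans (card_triangles_le_codeg R (G i)) _; apply: le_trans hi _.
suff : n i ^+ 3 / 48 <= n i * (n i - 1) * (n i - 2) / 6.
  by move=> /(ler_wpM2l (ltW e0)); lra.
move: (n i) n0 => x x4.
have : x ^+ 2 / 8 <= (x - 1) * (x - 2) by nra.
have -> : x ^+ 3 = x * x ^+ 2 by ring.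
move: (x ^+ 2) => y; rewrite -mulrA; nra.
Qed.

(** Forwards, the at most d n exceptional vertices have squared excess at most n^2 each, and the
    others have small excess. Backwards it is Chebyshev's inequality. *)
Lemma almost_regularP :
  almost_regular (1 / 3 : R) G <-> negligible 3 (fun i => deg_variance R (G i)).
Proof.
pose good d i u := `|(deg (G i) u)%:R / n i - 1 / 3| <= d :> R.
have goodE d i : #|[set u | good d i u]%SET|%:R = \sum_u (good d i u)%:R :> R.
  by rewrite card_setE natr_sum.
have sumC i (c : R) : \sum_(u : T i) c = n i * c by rewrite sumr_const mulr_natl.
have excessE i u : (2 <= #|T i|)%N ->
    excess (G i) (third R (T i)) u = n i * ((deg (G i) u)%:R / n i - 1 / 3) + 1 / 3.
  move=> n2; have n0 : 0 < n i by rewrite ltr0n (leq_trans _ n2).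
  by rewrite /excess /third; field; rewrite gt_eqF.
split=> h e e0.
  (* The bound obtained is (4 d^2 + d) n^3, at most 5 d n^3 as d <= 1. *)
  pose d := Num.min 1 (e / 5).
  have d0 : 0 < d by rewrite lt_min ltr01; lra.
  have d1 : d <= 1 by rewrite ge_min lexx.
  have d5 : 5 * d <= e by have : d <= e / 5 by [rewrite ge_min lexx orbT]; lra.
  apply: filterS3 (h _ d0) (card_near (1 / d)) (card_nearN 2) => i /= hi ni n2.
  have n0 : 2 <= n i by rewrite ler_nat.
  have dn : 1 <= d * n i by move: ni; rewrite ler_pdivrMr // mulrC.
  have bound u : excess (G i) (third R (T i)) u ^+ 2 <=
      4 * (d * n i) ^+ 2 + (1 - (good d i u)%:R) * n i ^+ 2.
    case gu: (good d i u).
      rewrite (excessE i u n2); move: gu; rewrite /good ler_norml; set x := _ - _ => /andP[x1 x2].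
      rewrite subrr mul0r addr0; have : - (d * n i) <= n i * x <= d * n i by apply/andP; split; nra.
      move: (n i * x) (d * n i) dn => y z z1 /andP[y1 y2]; nra.
    have : (deg (G i) u)%:R + 1 <= n i by rewrite natr1 ler_nat deg_lt_card.
    have : 0 <= (deg (G i) u)%:R :> R by [].
    have := sqr_ge0 (d * n i); rewrite subr0 mul1r.
    move: ((d * n i) ^+ 2) => y y0 x0 x1.
    have : - n i <= excess (G i) (third R (T i)) u <= n i.
      by rewrite /excess /third; apply/andP; split; lra.
    by move=> /andP[z1 z2]; nra.
  apply: (@le_trans _ _ (n i * (4 * (d * n i) ^+ 2) + d * n i * n i ^+ 2)).
    apply: le_trans (ler_sum _ (fun u _ => bound u)) _.
    rewrite big_split /= sumC lerD2l -mulr_suml ler_wpM2r ?sqr_ge0 //.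
    by rewrite sumrB sumr_const -goodE; move: hi; rewrite -/(good d i); lra.
  have -> : e * n i ^+ 3 = n i ^+ 3 * e by ring.
  have -> : n i * (4 * (d * n i) ^+ 2) + d * n i * n i ^+ 2 = n i ^+ 3 * (4 * d ^+ 2 + d) by ring.
  rewrite ler_wpM2l ?exprn_ge0 //; nra.
(* A bad vertex has excess at least e n - 1/3 >= e n / 2 in absolute value, and e n times (e n /
   2)^2 is e^3 / 4 n^3. *)
have e4 : 0 < e ^+ 3 / 4 by rewrite divr_gt0 // exprn_gt0.
apply: filterS3 (h _ e4) (card_near (1 / e)) (card_nearN 2) => i /= hi ni n2.
have n0 : 2 <= n i by rewrite ler_nat.
have en : 1 <= e * n i by move: ni; rewrite ler_pdivrMr // mulrC.
have bound u : (1 - (good e i u)%:R) * (e * n i / 2) ^+ 2 <= excess (G i) (third R (T i)) u ^+ 2.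
  case gu: (good e i u); first by rewrite subrr mul0r sqr_ge0.
  rewrite subr0 mul1r (excessE i u n2); move: gu => /negbT; rewrite /good -ltNge lter_normr.
  set x := _ - 1 / 3 => /orP[hx|hx].
    have : e * n i <= n i * x by nra.
    move: (n i * x) (e * n i) en => y z z1 yz; nra.
  have : e * n i <= - (n i * x) by nra.
  move: (n i * x) (e * n i) en => y z z1 yz; nra.
have : (n i - #|[set u | good e i u]%SET|%:R) * (e * n i / 2) ^+ 2 <= e * n i * (e * n i / 2) ^+ 2.
  have -> : e * n i * (e * n i / 2) ^+ 2 = e ^+ 3 / 4 * n i ^+ 3 by field.
  apply: le_trans hi; apply: le_trans (ler_sum _ (fun u _ => bound u)).
  by rewrite -mulr_suml sumrB sumr_const goodE.
rewrite ler_pM2r; last by rewrite exprn_gt0 //; lra.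
by rewrite /good; lra.
Qed.

Lemma lambda_stability : (lambda R H4 (G i) @[i --> \oo] --> (1 / 27 : R)) <->
  (triangle_density R (G i) @[i --> \oo] --> (0 : R)) /\
  almost_regular (1 / 3 : R) G.
Proof.
rewrite lambda_cvgP triangle_density_cvgP almost_regularP; split.
  by move=> h; split; [exact: negligible_codeg | exact: negligible_deg_variance].
by case=> hC hA; exact: negligible_shortfall.
Qed.

End Stability.

Section Density.
Variable R : realType.

Lemma lambda_maxE n : lambda_max R H4 n = (Lambda_max H4 n)%:R / (n ^_ 4)%:R.
Proof.
rewrite /lambda_max /Lambda_max.
rewrite (@big_morph _ _ (fun k => k%:R / (n ^_ 4)%:R : R) 0 Num.max 0%N maxn); first last.
- by rewrite mul0r.
- move=> k l /=; have [kl|lk] := leqP k l.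
    by rewrite max_r // ler_wpM2r ?invr_ge0 // ler_nat.
  by rewrite max_l // ler_wpM2r ?invr_ge0 // ler_nat ltnW.
by apply: eq_bigr => G _; rewrite /lambda !card_ord.
Qed.

(** Replacing [pi3] by the real cube costs at most 7 n^2, since (m + 1)^3 - m^3 is that small; times
    n this is cubic, like the final bound. *)
Lemma Lambda_max_shortfall n : (4 <= n)%N ->
  (0 <= n%:R * ((n%:R - 1) / 3) ^+ 3 - (Lambda_max H4 n)%:R :> R) /\
  (n%:R * ((n%:R - 1) / 3) ^+ 3 - (Lambda_max H4 n)%:R <= 200 * n%:R ^+ 3 :> R).
Proof.
move=> n4; split.
  have [G _ ->] : {G : sgraph 'I_n | true & Lambda_max H4 n = Lambda H4 G}.
    by apply: eq_bigmax_cond; apply/card_gt0P; exists (graph_of (fun _ _ => false)).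
  have c2 : (2 <= #|'I_n|)%N by rewrite card_ord (leq_trans _ n4).
  by have := shortfall_ge0 R G c2; rewrite /shortfall /third card_ord.
have := Lambda_max_close n4; rewrite -(ler_nat R) natrD natrM [in X in _ + X]natrM natrX.
pose m := (n.-1 %/ 3)%N.
have : (m * m * m <= pi3 n.-1)%N.
  by apply: leq_trans (@leq_pi3 _ m m (n.-1 - m - m) _); [rewrite leq_mul2l; lia | lia].
rewrite -(ler_nat R) 2!natrM.
have : n%:R <= 3 * m%:R + 3 :> R by rewrite -natrM -natrD ler_nat; lia.
have : 3 * m%:R + 1 <= n%:R :> R by rewrite -natrM natr1 ler_nat; lia.
have : 0 <= m%:R :> R by [].
have : 4 <= n%:R :> R by rewrite ler_nat.
move: (n%:R) (m%:R) ((pi3 n.-1)%:R) ((Lambda_max H4 n)%:R) => x y p l x4 y0 h1 h2 h3 h4.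
have h5 : ((x - 1) / 3) ^+ 3 <= (y + 1) ^+ 3.
  rewrite lerXn2r ?nnegrE; lra.
have h6 : (y + 1) ^+ 3 <= p + 7 * x ^+ 2.
  have -> : (y + 1) ^+ 3 = y * y * y + (3 * y ^+ 2 + 3 * y + 1) by ring.
  nra.
have : x * ((x - 1) / 3) ^+ 3 <= x * (p + 7 * x ^+ 2).
  by rewrite ler_wpM2l //; [lra | exact: le_trans h6].
have : x ^+ 2 <= x ^+ 3 by rewrite (exprS _ 2); have := sqr_ge0 x; nra.
have -> : x * (p + 7 * x ^+ 2) = x * p + 7 * x ^+ 3 by ring.
have := sqr_ge0 x; lra.
Qed.

Lemma lambda_max_cvg : lambda_max R H4 n @[n --> \oo] --> (1 / 27 : R).
Proof.
apply/cvgrPdist_le => e e0.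
(* From n >= 1600 / e one gets 200 n^3 <= e / 8 n^4, as [density_dist_le] requires. *)
have : \forall n \near \oo, (maxn 6 (Num.bound (1600 / e)) <= n)%N by exact: nbhs_infty_ge.
apply: filterS => n; rewrite geq_max => /andP[n6 ne].
have n4 : (4 <= n)%N by rewrite (leq_trans _ n6).
have [D0 D1] := Lambda_max_shortfall n4.
have en : 1600 <= e * n%:R.
  have e16 : 0 < 1600 / e by apply: divr_gt0; rewrite ?ltr0n.
  have : 1600 / e <= n%:R.
    by apply: le_trans (ltW (archi_boundP (ltW e16))) _; rewrite ler_nat.
  by rewrite ler_pdivrMr // mulrC.
have N6 : 6 <= n%:R :> R by rewrite ler_nat.
have n3 : (3 <= n)%N by rewrite (leq_trans _ n6).
rewrite lambda_maxE; apply: (@density_dist_le _ _ _ _ _ N6 (ffact4E R n3) D0 erefl); last lra.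
apply: le_trans D1 _; rewrite (exprS _ 3).
have : 0 <= n%:R ^+ 3 :> R by rewrite exprn_ge0.
by move=> /ler_wpM2r /(_ _ _ en); lra.
Qed.

End Density.

Lemma unbalanced_bounds (R : realType) : exists C : R, forall n k : nat, (0 < k)%N ->
  n = (6 * k + 1)%N \/ n = (6 * k + 4)%N ->
  exists e1 e2 : R,
    [/\ `|e1| <= C * k%:R, `|e2| <= C * k%:R,
        6 * k%:R ^+ 2 + e1 <= (n * pi3 n.-1)%:R - (Lambda_max H4 n)%:R &
        (n * pi3 n.-1)%:R - (Lambda_max H4 n)%:R <= 15 / 2 * k%:R ^+ 2 + e2].
Proof.
exists 600 => n k k0 nk; exists (- (600 * k%:R)), (600 * k%:R).
have k1 : 1 <= k%:R :> R by rewrite ler1n.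
have k600 : 0 <= 600 * k%:R :> R by lra.
split; rewrite ?normrN ?ger0_norm //.
  have [m [nm mk]] : exists m, n = (3 * m + 1)%N /\ (2 * k <= m <= 2 * k + 1)%N.
    by case: nk => nk; [exists (2 * k)%N | exists (2 * k + 1)%N]; lia.
  have := Lambda_max_upper_unbalanced k0 nm mk.
  rewrite -(ler_nat R) [in X in X <= _]natrD [in X in _ <= X]natrD !(natrM _ 6%N, natrM _ 600%N) natrX.
  lra.
have [U HU hU] : exists2 U, (2 * U <= 15 * k ^ 2 + 16 * k + 14)%N &
    (n * pi3 n.-1 <= Lambda_max H4 n + U)%N.
  case: nk => nk; last exact: Lambda_max_lower_even.
  by have [U HU hU] := Lambda_max_lower_odd k0 nk; exists U => //; lia.
(* As k >= 1, the constant terms are absorbed into multiples of k. *)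
have {}HU : (2 * U <= 15 * k ^ 2 + 30 * k)%N by lia.
have E : (15 * k ^ 2 + 30 * k)%:R = 15 * k%:R ^+ 2 + 30 * k%:R :> R.
  by rewrite natrD (natrM _ 15%N) (natrM _ 30%N) natrX.
by move: HU hU; rewrite -!(ler_nat R) (natrM _ 2%N) E natrD; lra.
Qed.

Theorem theorem3p9 (R : realType) :
  [/\ (forall n : nat, (4 <= n)%N -> (Lambda_max H4 n <= n * pi3 n.-1)%N),
      (forall n : nat, (4 <= n)%N -> (n %% 6 \in [:: 0; 2; 5])%N ->
         Lambda_max H4 n = (n * pi3 n.-1)%N /\
         forall (T : finType) (G : sgraph T), #|T| = n ->
           (Lambda H4 G = Lambda_max H4 n <->
            regular ((n + 2) %/ 3) G /\ triangle_free G)),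
      (forall n k : nat, (4 <= n)%N -> n = (6 * k + 3)%N ->
         (Lambda_max H4 n + 2 * k = n * pi3 n.-1)%N /\
         forall (T : finType) (G : sgraph T), #|T| = n ->
           (Lambda H4 G = Lambda_max H4 n <->
            [/\ triangle_free G,
                #|[set u | deg G u == (2 * k + 1)%N]%SET| = n.-1 &
                #|[set u | deg G u == (2 * k + 2)%N]%SET| = 1%N])),
      (exists C : R, forall n k : nat, (0 < k)%N ->
         n = (6 * k + 1)%N \/ n = (6 * k + 4)%N ->
         exists e1 e2 : R,
           [/\ `|e1| <= C * k%:R, `|e2| <= C * k%:R,
               6 * k%:R ^+ 2 + e1
                 <= (n * pi3 n.-1)%:R - (Lambda_max H4 n)%:R &
               (n * pi3 n.-1)%:R - (Lambda_max H4 n)%:R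
                 <= 15 / 2 * k%:R ^+ 2 + e2]) &
      (cvgn (lambda_max R H4) /\ lambda_lim R H4 = 1 / 27) /\
      (forall (T : nat -> finType) (G : forall i, sgraph (T i)),
         #|T i| @[i --> \oo] --> \oo ->
         (lambda R H4 (G i) @[i --> \oo] --> (1 / 27 : R) <->
          triangle_density R (G i) @[i --> \oo] --> (0 : R) /\
          almost_regular (1 / 3 : R) G))].
Proof.
split.
- by move=> n _; exact: Lambda_max_upper.
- exact: Lambda_max_regular.
- exact: Lambda_max_near_regular.
- exact: unbalanced_bounds.
split; last by move=> T G; exact: lambda_stability.
by split; [apply: cvgP; exact: lambda_max_cvg | apply: cvg_lim; [|exact: lambda_max_cvg]].
Qed.
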